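(* For every fixed $d,m_1,\dots,m_d$, there is an algorithm that, given $n$, an integer $m_1\times\cdots\times m_d\times n$ cost array $w$, and integer line-sums $v=((v_{*,i_2,\dots,i_{d+1}}),\dots,(v_{i_1,\dots,i_d,*}))$, solves, in time polynomial in $n$ and $\langle w,v\rangle$, the $(d+1)$-index transportation problem $$\min\left\{wx\ :\ x\in\mathbb{Z}_+^{m_1\times\cdots\times m_d\times n},\ \sum_{i_1}x_{i_1,\dots,i_{d+1}}=v_{*,i_2,\dots,i_{d+1}},\ \dots,\ \sum_{i_{d+1}}x_{i_1,\dots,i_{d+1}}=v_{i_1,\dots,i_d,*}\right\}.$$
   Context: Here $d,m_1,\dots,m_d,n$ are positive integers, $\mathbb{Z}_+$ is the set of nonnegative integers, and arrays $x=(x_{i_1,\dots,i_{d+1}})$ are indexed by $1\le i_j\le m_j$ for $j=1,\dots,d$ and $1\le i_{d+1}\le n$. For each of the $d+1$ coordinates $j$, there is one line-sum equation for every choice of the other $d$ indices, requiring that the sum of $x_{i_1,\dots,i_{d+1}}$ over $i_j$ equal the prescribed integer $v_{i_1,\dots,i_{j-1},*,i_{j+1},\dots,i_{d+1}}$. $wx=\sum w_{i_1,\dots,i_{d+1}}x_{i_1,\dots,i_{d+1}}$, and $\langle\cdot\rangle$ denotes binary-encoding length. An algorithm solves an integer programming problem if it either finds an optimal solution or concludes that the feasible set is infinite or empty. *)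

(* Defs.v *)
From mathcomp Require Import all_boot all_order all_algebra.

Set Implicit Arguments.
Unset Strict Implicit.
Unset Printing Implicit Defensive.

Import Order.TTheory GRing.Theory Num.Theory.

Local Open Scope ring_scope.

(** * Machine model

    A structured random access machine over the integers with logarithmic
    (bit) cost: every operation is charged the binary lengths of its operands,
    of its result and of the memory address involved.  Up to a polynomial, this
    is Turing machine time.  A program is a finite piece of syntax; the memory
    is a family of integer arrays, of which a program can name finitely many
    (array names are literals, array indices are computed). *)

(* Binary length of an integer: a sign bit and ceil(log2(|z| + 1)) digits. *)
Definition bitlen (z : int) : nat := (up_log 2 `|z|%N.+1).+1.

Inductive binop := Add | Sub | Mul | Quo | Leq.

Definition binop_eval (o : binop) (a b : int) : int :=
  match o with
  | Add => a + b
  | Sub => a - b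
  | Mul => a * b
  | Quo => (a %/ b)%Z
  | Leq => if a <= b then 1 else 0
  end.

Inductive expr :=
  | Cst of int
  | Get of nat & expr
  | Bin of binop & expr & expr.

Inductive prog :=
  | Skip
  | Put of nat & expr & expr
  | Seq of prog & prog
  | If of expr & prog & prog
  | While of expr & prog.

(* [s k a] is the content of cell [a] of the array named [k]. *)
Definition store := nat -> int -> int.

Definition upd (s : store) (k : nat) (a z : int) : store :=
  fun k' a' => if (k' == k) && (a' == a) then z else s k' a'.

Fixpoint eval (s : store) (e : expr) : int :=
  match e with
  | Cst z => z
  | Get k e1 => s k (eval s e1)
  | Bin o e1 e2 => binop_eval o (eval s e1) (eval s e2)
  end.

Fixpoint ecost (s : store) (e : expr) : nat :=
  match e with
  | Cst z => bitlen z
  | Get k e1 => (ecost s e1 + bitlen (eval s e1) + bitlen (eval s e))%N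
  | Bin o e1 e2 => (ecost s e1 + ecost s e2 + bitlen (eval s e1)
                    + bitlen (eval s e2) + bitlen (eval s e))%N
  end.

(* [exec c s t s']: started in [s], the program [c] halts in [s'] at cost [t].
   In tests, nonzero means true. *)
Inductive exec : prog -> store -> nat -> store -> Prop :=
  | exec_skip s : exec Skip s 1 s
  | exec_put s k e1 e2 :
      exec (Put k e1 e2) s
        (ecost s e1 + ecost s e2 + bitlen (eval s e1) + bitlen (eval s e2))
        (upd s k (eval s e1) (eval s e2))
  | exec_seq c1 c2 s s1 s2 t1 t2 :
      exec c1 s t1 s1 -> exec c2 s1 t2 s2 ->
      exec (Seq c1 c2) s (t1 + t2) s2
  | exec_if_true e c1 c2 s s1 t :
      eval s e != 0 -> exec c1 s t s1 ->
      exec (If e c1 c2) s (ecost s e + t) s1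
  | exec_if_false e c1 c2 s s1 t :
      eval s e = 0 -> exec c2 s t s1 ->
      exec (If e c1 c2) s (ecost s e + t) s1
  | exec_while_false e c s :
      eval s e = 0 -> exec (While e c) s (ecost s e) s
  | exec_while_true e c s s1 s2 t1 t2 :
      eval s e != 0 -> exec c s t1 s1 -> exec (While e c) s1 t2 s2 ->
      exec (While e c) s (ecost s e + t1 + t2) s2.

(** * Multi-indexed arrays *)

(* Tuples (i_0, ..., i_{D-1}) with i_j < b_j. *)
Definition mindex (D : nat) (b : 'I_D -> nat) : finType :=
  {dffun forall j : 'I_D, 'I_(b j)}.

(* Mixed-radix position of an index, the first coordinate varying fastest. *)
Definition flat_pos (D : nat) (b : 'I_D -> nat) (i : mindex b) : nat :=
  (\sum_(j < D) i j * \prod_(k < D | (k < j)%N) b k)%N.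

(* The one-dimensional layout in memory of an integer array, padded by 0. *)
Definition layout (D : nat) (b : 'I_D -> nat) (w : {ffun mindex b -> int})
    (a : int) : int :=
  if [pick i : mindex b | (flat_pos i)%:Z == a] is Some i then w i else 0.

Definition array_size (D : nat) (b : 'I_D -> nat)
    (w : {ffun mindex b -> int}) : nat :=
  (\sum_i bitlen (w i))%N.

(** * The (d+1)-index transportation problem *)

(* The side lengths m_1, ..., m_d, n. *)
Definition sides (d : nat) (m : 'I_d -> nat) (n : nat) (j : 'I_d.+1) : nat :=
  if unlift ord_max j is Some k then m k else n.

(* Omitting coordinate [j]: [lift j] enumerates the other coordinates. *)
Definition omit_sides (d : nat) (b : 'I_d.+1 -> nat) (j : 'I_d.+1)
    (k : 'I_d) : nat := b (lift j k).

Definition omit (d : nat) (b : 'I_d.+1 -> nat) (j : 'I_d.+1) (i : mindex b) :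
    mindex (omit_sides b j) :=
  [ffun k : 'I_d => i (lift j k)].

(* [v j l] is the prescribed sum of the line in direction [j] whose other
   coordinates are [l]. *)
Definition line_sums (d : nat) (b : 'I_d.+1 -> nat) : Type :=
  forall j : 'I_d.+1, {ffun mindex (omit_sides b j) -> int}.

Definition transport_feasible (d : nat) (b : 'I_d.+1 -> nat) (v : line_sums b)
    (x : {ffun mindex b -> nat}) : Prop :=
  forall (j : 'I_d.+1) (l : mindex (omit_sides b j)),
    \sum_(i : mindex b | omit j i == l) (x i)%:Z = v j l.

Definition transport_cost (D : nat) (b : 'I_D -> nat) (w : {ffun mindex b -> int})
    (x : {ffun mindex b -> nat}) : int :=
  \sum_i w i * (x i)%:Z.

Definition line_sums_size (d : nat) (b : 'I_d.+1 -> nat) (v : line_sums b) : nat :=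
  (\sum_j array_size (v j))%N.

(** * Solving an integer program *)

Inductive outcome (X : Type) := Optimal of X | Empty | Infinite.
Arguments Empty {X}.
Arguments Infinite {X}.

Definition solves (X : eqType) (feasible : X -> Prop) (cost : X -> int)
    (o : outcome X) : Prop :=
  match o with
  | Optimal x => feasible x /\ forall y, feasible y -> cost x <= cost y
  | Empty => forall y, ~ feasible y
  | Infinite => ~ exists s : seq X, forall y, feasible y -> y \in s
  end.

(* Input convention: n is in cell 0 of array 0, w in array 1, and the line
   sums in direction j (counted from 0) in array 2 + j; other cells are 0. *)
Definition input_store (d : nat) (m : 'I_d -> nat) (n : nat)
    (w : {ffun mindex (sides m n) -> int}) (v : line_sums (sides m n)) : store :=
  fun k a =>
    match k with
    | 0 => if a == 0 then n%:Z else 0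
    | 1 => layout w a
    | k'.+2 => if insub k' is Some j then layout (v j) a else 0
    end.

(* Output convention: cell 0 of array 0 holds a verdict code, and array 1 the
   solution if there is one. *)
Definition outputs (D : nat) (b : 'I_D -> nat) (s : store)
    (o : outcome {ffun mindex b -> nat}) : Prop :=
  match o with
  | Empty => s 0%N 0 = 0
  | Optimal x => s 0%N 0 = 1 /\ forall i : mindex b, s 1%N (flat_pos i)%:Z = (x i)%:Z
  | Infinite => s 0%N 0 = 2
  end.

(* Main.v *)
Require Import Defs.
From HB Require Import structures.
From Stdlib Require Import Classical FunctionalExtensionality.
From mathcomp Require Import all_boot all_order all_algebra.
From mathcomp Require Import zify ring.
Import Defs.

Set Implicit Arguments.
Unset Strict Implicit.
Unset Printing Implicit Defensive.

Import Order.TTheory GRing.Theory Num.Theory.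

Local Open Scope ring_scope.

(** The problem is solved by a local search in the set of all integer arrays, where infeasibility is
    only penalised. The objective [obj] is the cost plus [penalty] times [defect], the total
    violation of the line sums and of the signs. The penalty is so large that an array with a
    positive defect is worse than every feasible one ([obj_feasible], [obj_infeasible]); so a
    minimiser of [obj] over all integer arrays either is an optimal solution or shows that there
    is none. The feasible set is never infinite, as an entry is bounded by the sums of its lines.
    The search starts from the zero array, and needs neither a feasible point nor a separate
    phase to find one.

    The search repeatedly adds the best vector of the form [2^t g], where [g] has l1-norm at most a
    constant [K] that depends on [d] and the [m j] only; for fixed [K] the number of such [g] is
    polynomial in [n], and they are enumerated by [K] nested loops. That these steps suffice is a
    matter of conformality: [g] is conformal to [z] when every entry and every line sum of [g]
    lies between 0 and that of [z]. Since [obj] is a sum of convex functions of the entries and of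
    the line sums, it is superadditive along decompositions into conformal vectors
    ([obj_superadditive]). Two applications of Dickson's lemma, one for a single layer and one for
    the way in which layers combine, show that every array is a conformal sum of arrays of norm at
    most [K] ([bounded_conformal_piece]). Merging equal summands in pairs turns the difference
    between the current array and an optimal one into a sum of polynomially many distinct vectors
    [2^t g] ([binary_decomposition]), and one of them closes an inverse polynomial fraction of the gap
    ([improving_step]). The gap is an integer that shrinks geometrically, so polynomially many
    rounds close it ([does_search]).

    The bit cost is reduced to a count of steps. In each block of the program every product has a
    factor whose length is bounded in terms of cells that the block does not change, so that the
    longest cell grows by a bounded number of bits per step ([runs_exec_le]): a polynomial number
    of steps on cells of polynomial length has polynomial bit cost. Hence no invariant about the
    size of intermediate values is needed, and the step counts of the nested loops are explicit
    polynomials. *)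

(** * Conformal decompositions *)

(** Dickson's lemma, for the vectors of natural numbers [psi z] indexed by [es]. A finite [G0]
    that dominates on [es] also dominates at a further coordinate [e] all the points that are
    large there; the remaining points form finitely many slices of constant value at [e]. *)
Lemma dickson (T E : eqType) (psi : T -> E -> nat) (es : seq E) (S : T -> Prop) :
  exists G : seq T, (forall g, g \in G -> S g) /\
    forall z, S z -> exists2 g, g \in G & forall e, e \in es -> (psi g e <= psi z e)%N.
Proof.
elim: es S => [|e es IH] S.
  case: (classic (exists z, S z)) => [[z Sz]|nS].
    by exists [:: z]; split=> [g|y _]; [rewrite inE => /eqP->|exists z; rewrite ?mem_head].
  by exists [::]; split=> // z Sz; case: nS; exists z.
have [G0 [SG0 dG0]] := IH S.
pose c := (\max_(g <- G0) psi g e)%N.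
have leG0 g : g \in G0 -> (psi g e <= c)%N by move=> gG; rewrite /c (big_rem g) //= leq_maxl.
have [G1 [SG1 dG1]] : exists G1 : seq T, (forall g, g \in G1 -> S g) /\
    forall z, S z -> (psi z e < c)%N ->
      exists2 g, g \in G1 & forall e', e' \in e :: es -> (psi g e' <= psi z e')%N.
  elim: (c) => [|k [G [SG dG]]]; first by exists [::].
  have [H [SH dH]] := IH (fun z => S z /\ psi z e = k).
  exists (G ++ H); split=> [g|z Sz]; rewrite ?mem_cat ?ltnS.
    by case/orP=> [/SG|/SH[]].
  rewrite leq_eqVlt => /orP[/eqP zk|zk]; last first.
    by have [g gG gz] := dG _ Sz zk; exists g => //; rewrite mem_cat gG.
  have [g gH gz] := dH z (conj Sz zk); exists g; first by rewrite mem_cat gH orbT.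
  move=> e'; rewrite inE => /orP[/eqP->|]; last exact: gz.
  by rewrite zk; case: (SH g gH) => _ ->.
exists (G0 ++ G1); split=> [g|z Sz]; rewrite ?mem_cat.
  by case/orP=> [/SG0|/SG1].
case: (ltnP (psi z e) c) => [zc|cz].
  by have [g gG gz] := dG1 z Sz zc; exists g => //; rewrite mem_cat gG orbT.
have [g gG gz] := dG0 z Sz; exists g; first by rewrite mem_cat gG.
move=> e'; rewrite inE => /orP[/eqP->|]; last exact: gz.
exact: leq_trans (leG0 _ gG) cz.
Qed.

Definition between (u z : int) : bool := (0 <= u <= z) || (z <= u <= 0).

(** The two nonnegative parts of an integer turn [between] into a componentwise order on
    natural numbers, to which [dickson] applies. *)
Definition pos_part (z : int) : nat := if 0 <= z then `|z|%N else 0.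

Lemma between_pos_part u z :
  (pos_part u <= pos_part z)%N -> (pos_part (- u) <= pos_part (- z))%N -> between u z.
Proof. by rewrite /pos_part /between; case: (lerP 0 u); case: (lerP 0 z); case: (lerP 0 (- u)); case: (lerP 0 (- z)); lia. Qed.

Lemma between_refl z : between z z. Proof. rewrite /between; lia. Qed.

(** A sum of integers that all lie between 0 and the total has no cancellation. *)
Lemma between_sum_sign (I : eqType) (s : seq I) (f : I -> int) (z : int) :
  (forall i, i \in s -> between (f i) z) ->
  [/\ between (\sum_(i <- s) f i) (\sum_(i <- s) f i),
      (0 <= z -> 0 <= \sum_(i <- s) f i) & (z <= 0 -> \sum_(i <- s) f i <= 0)].
Proof.
move=> bs; split; first exact: between_refl.
  move=> z0; rewrite big_seq sumr_ge0 // => i /bs; rewrite /between; lia.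
move=> z0; rewrite big_seq sumr_le0 // => i /bs; rewrite /between; lia.
Qed.

(** Summands that all point towards the total can be dropped without overshooting it. *)
Lemma between_sub_sum (I : eqType) (s s1 s2 : seq I) (f : I -> int) (z : int) :
  perm_eq s (s1 ++ s2) -> (forall i, i \in s -> between (f i) z) ->
  \sum_(i <- s) f i = z -> between (\sum_(i <- s1) f i) z.
Proof.
move=> ps bs; rewrite (perm_big _ ps) big_cat /=.
have [_ p1 n1] := @between_sum_sign _ s1 f z (fun i h => bs i ltac:(by rewrite (perm_mem ps) mem_cat h)).
have [_ p2 n2] := @between_sum_sign _ s2 f z (fun i h => bs i ltac:(by rewrite (perm_mem ps) mem_cat h orbT)).
move: p1 n1 p2 n2; set A := \sum_(i <- s1) f i; set B := \sum_(i <- s2) f i.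
by rewrite /between; case: (lerP 0 z) => z0; [move=> /(_ isT) ? _ /(_ isT) ? _ | move=> _ /(_ (ltW z0)) ? _ /(_ (ltW z0)) ?]; lia.
Qed.

Lemma between_sum_eq0 (I : eqType) (s : seq I) (f : I -> int) (z : int) (i : I) :
  (forall i, i \in s -> between (f i) z) -> \sum_(i <- s) f i = 0 -> i \in s -> f i = 0.
Proof.
move=> bs + si; rewrite (big_rem i) //=.
have [_ p n] := @between_sum_sign _ (rem i s) f z (fun i' h => bs i' (mem_rem h)).
move: p n (bs i si); set A := \sum_(_ <- _) _; rewrite /between.
by case: (lerP 0 z) => z0; [move=> /(_ isT) ? _ | move=> _ /(_ (ltW z0)) ?]; lia.
Qed.

Section Conformal.
Variables (V : zmodType) (E : finType) (phi : E -> V -> int).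
Hypothesis phiD : forall e u v, phi e (u + v) = phi e u + phi e v.
Hypothesis phi_inj : forall z, (forall e, phi e z = 0) -> z = 0.

(** The forms [phi] may comprise more than the coordinates. A function that is a sum of convex
    functions of the single forms [phi e] is then superadditive along a sum of vectors that
    are all conformal to the total. *)
Definition conformal (u z : V) : bool := [forall e, between (phi e u) (phi e z)].

Lemma phi0 e : phi e 0 = 0.
Proof. by have := phiD e 0 0; rewrite addr0; lia. Qed.

Lemma phi_sum e (I : Type) (s : seq I) (f : I -> V) :
  phi e (\sum_(i <- s) f i) = \sum_(i <- s) phi e (f i).
Proof. exact: (big_morph (phi e) (phiD e) (phi0 e)). Qed.

Lemma phiB e u v : phi e (u - v) = phi e u - phi e v.
Proof. by have := phiD e (u - v) v; rewrite subrK; lia. Qed.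

Lemma conformalP u z : reflect (forall e, between (phi e u) (phi e z)) (conformal u z).
Proof. exact: forallP. Qed.

Definition weight (z : V) : nat := \sum_e `|phi e z|%N.

Lemma weight_eq0 z : weight z = 0%N -> z = 0.
Proof.
move/eqP; rewrite sum_nat_eq0 => /forallP h; apply: phi_inj => e.
by have := h e; rewrite /= => /eqP; lia.
Qed.

Lemma weight_sub g z : conformal g z -> (weight g + weight (z - g) = weight z)%N.
Proof.
move/conformalP=> gz; rewrite /weight -big_split /=; apply: eq_bigr => e _.
by have := gz e; rewrite phiB /between; lia.
Qed.

(** Peeling off one piece leaves a remainder that is still conformal and strictly lighter. *)
Lemma conformal_decomposition (P : V -> Prop) :
  (forall z, z != 0 -> exists g, [/\ P g, g != 0 & conformal g z]) ->
  forall z, exists2 gs : seq V,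
    (forall g, g \in gs -> [/\ P g, g != 0 & conformal g z]) & \sum_(g <- gs) g = z.
Proof.
move=> piece z; have [k] := ubnP (weight z); elim: k z => // k IH z; rewrite ltnS => zk.
have [->|z0] := eqVneq z 0; first by exists [::]; rewrite ?big_nil.
have [g [Pg g0 gz]] := piece z z0.
have wg : (0 < weight g)%N.
  by rewrite lt0n; apply: contra g0 => /eqP/weight_eq0 ->.
have [gs gsP gsE] := IH (z - g) ltac:(by have := weight_sub gz; lia).
exists (g :: gs); last by rewrite big_cons gsE addrC subrK.
move=> h; rewrite inE => /orP[/eqP->//|/gsP[Ph h0 hz]]; split=> //.
apply/conformalP=> e; move/conformalP/(_ e): hz; move/conformalP/(_ e): gz.
by rewrite phiB /between; lia.
Qed.

End Conformal.

(** * Lines of a layered array *)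

(** For [q = (P, Q)], the mixed-radix number obtained from [a] by deleting the digit of weight
    [P] and base [Q %/ P]. With [Q = 0] the top digit is deleted, whatever its base, because
    [a %/ 0 = 0]. Two positions lie on the same line of a direction when their keys agree. *)
Definition key (q : nat * nat) (a : nat) : nat := (a %% q.1 + q.1 * (a %/ q.2))%N.

Definition vec (N : nat) : Type := {ffun 'I_N -> int}.
HB.instance Definition _ N := GRing.Zmodule.on (vec N).

Definition line N (q : nat * nat) (z : vec N) (a : nat) : int :=
  \sum_(b < N | key q b == key q a) z b.

Lemma lineD N q (u v : vec N) a : line q (u + v) a = line q u a + line q v a.
Proof. by rewrite /line -big_split; apply: eq_bigr => b _; rewrite ffunE. Qed.

(** The linear forms of which the objective is a sum of convex functions: the entries, and the
    line sums in the directions [qs]. *)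
Definition form (qs : seq (nat * nat)) N (e : option 'I_(size qs) * 'I_N) (z : vec N) : int :=
  if e.1 is Some j then line (nth (0%N, 0%N) qs j) z e.2 else z e.2.

Arguments form : simpl never.

Lemma formD qs N (e : option 'I_(size qs) * 'I_N) u v :
  form e (u + v) = form e u + form e v.
Proof. by rewrite /form; case: e.1 => [j|]; rewrite ?lineD ?ffunE. Qed.

Lemma form_inj qs N (z : vec N) :
  (forall e : option 'I_(size qs) * 'I_N, form e z = 0) -> z = 0.
Proof. by move=> h; apply/ffunP => a; rewrite ffunE; exact: (h (None, a)). Qed.

(** An array of positions is cut into consecutive layers of length [M]. The pair [(M, 0)] is the
    direction running across the layers; the lines of the other ones stay within a layer. *)
Definition direction_of (M : nat) (q : nat * nat) : bool :=
  (0 < q.1)%N && ((q == (M, 0%N)) || [&& 0 < q.2, q.1 %| q.2 & q.2 %| M]%N).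

Section Layers.
Variables (M : nat) (M_gt0 : (0 < M)%N).

Fact layer_index_subproof n (k : 'I_n) (p : 'I_M) : (k * M + p < n * M)%N.
Proof. by clear M_gt0; have := ltn_ord k; have := ltn_ord p; nia. Qed.

Definition layer_index n (k : 'I_n) (p : 'I_M) : 'I_(n * M) :=
  Ordinal (layer_index_subproof k p).
Arguments layer_index : simpl never.

Fact layer_of_subproof n (a : 'I_(n * M)) : (a %/ M < n)%N.
Proof. by rewrite ltn_divLR. Qed.

Definition layer_of n (a : 'I_(n * M)) : 'I_n := Ordinal (layer_of_subproof a).

Definition place_of n (a : 'I_(n * M)) : 'I_M := Ordinal (ltn_pmod a M_gt0).

Lemma layer_indexK n (a : 'I_(n * M)) : layer_index (layer_of a) (place_of a) = a.
Proof. by apply: val_inj; rewrite /layer_index /= -divn_eq. Qed.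

Lemma layer_of_index n k p : layer_of (@layer_index n k p) = k.
Proof. by apply: val_inj; rewrite /layer_index /= divnMDl // divn_small ?addn0 ?ltn_ord. Qed.

Lemma place_of_index n k p : place_of (@layer_index n k p) = p.
Proof. by apply: val_inj; rewrite /layer_index /= modnMDl modn_small ?ltn_ord. Qed.

Lemma sum_layers (R : Type) (idx : R) (op : Monoid.com_law idx) n (F : 'I_(n * M) -> R) :
  \big[op/idx]_a F a = \big[op/idx]_(k < n) \big[op/idx]_(p < M) F (layer_index k p).
Proof.
rewrite pair_big /= (reindex (fun kp : 'I_n * 'I_M => layer_index kp.1 kp.2)) //=.
apply: onW_bij; exists (fun a => (layer_of a, place_of a)) => [[k p]|a] /=.
  by rewrite layer_of_index place_of_index.
exact: layer_indexK.
Qed.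

Lemma key_local q n (k k' : 'I_n) (p p' : 'I_M) :
  (0 < q.1)%N -> [&& 0 < q.2, q.1 %| q.2 & q.2 %| M]%N ->
  (key q (layer_index k p) == key q (layer_index k' p')) = (k == k') && (key q p == key q p').
Proof.
case: q => P Q /= P0 /and3P[Q0 PQ QM].
have E (j r : nat) : key (P, Q) (j * M + r) = (j * (P * (M %/ Q)) + key (P, Q) r)%N.
  rewrite /key /=; have PM := dvdn_trans PQ QM.
  rewrite -{1}(divnK PM) mulnA modnMDl -{1}(divnK QM) mulnA divnMDl //; ring.
have L (r : 'I_M) : (key (P, Q) r < P * (M %/ Q))%N.
  rewrite /key /=; have : (r %/ Q < M %/ Q)%N by rewrite ltn_divLR // divnK.
  by have := ltn_pmod r P0; nia.
rewrite /layer_index /= !E; have := L p; have := L p'.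
move: (key _ p) (key _ p') => x y; set C := (P * _)%N => hy hx.
apply/eqP/andP => [e|[/eqP -> /eqP ->] //].
have kk : (k : nat) = k' by have := congr1 (divn^~ C) e; rewrite !divnMDl ?divn_small //; lia.
by split; [apply/eqP/val_inj | apply/eqP; move: e; rewrite kk; lia].
Qed.

Definition embed n (kg : 'I_n * vec M) : vec (n * M) :=
  [ffun a => if layer_of a == kg.1 then kg.2 (place_of a) else 0].

Definition layer n (z : vec (n * M)) (k : 'I_n) : vec M := [ffun p => z (layer_index k p)].

Lemma line_embed n (kg : 'I_n * vec M) q (a : 'I_(n * M)) : direction_of M q ->
  line q (embed kg) a =
  if q.2 == 0%N then kg.2 (place_of a)
  else if layer_of a == kg.1 then line q kg.2 (place_of a) else 0.
Proof.
case: kg => k g /andP[P0 /orP[/eqP->|loc]] /=.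
  have kE (r : nat) : key (M, 0%N) r = (r %% M)%N by rewrite /key /= divn0 muln0 addn0.
  have kI (i : 'I_n) (p : 'I_M) :
      (key (M, 0%N) (layer_index i p) == key (M, 0%N) a) = (p == place_of a).
    by rewrite !kE /layer_index /= modnMDl modn_small.
  rewrite /line big_mkcond sum_layers (bigD1 k) //= [X in _ + X]big1 ?addr0; last first.
    move=> i ik; rewrite big1 // => p _; rewrite ffunE layer_of_index /= (negPf ik).
    by case: ifP.
  rewrite (bigD1 (place_of a)) //= [X in _ + X]big1 ?addr0; last first.
    by move=> p pa; rewrite (kI k p) (negPf pa).
  by rewrite (kI k (place_of a)) eqxx ffunE layer_of_index eqxx place_of_index.
have /negPf-> : q.2 != 0%N by case/and3P: loc; lia.
rewrite /line big_mkcond sum_layers (bigD1 k) //= [X in _ + X]big1 ?addr0; last first.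
  move=> i ik; rewrite big1 // => p _; rewrite ffunE layer_of_index /= (negPf ik).
  by case: ifP.
have kE (p : 'I_M) :
    (key q (layer_index k p) == key q a) = (k == layer_of a) && (key q p == key q (place_of a)).
  by rewrite -[in LHS](layer_indexK a) key_local.
under eq_bigr => p _.
  rewrite (kE p) ffunE layer_of_index place_of_index eqxx.
  over.
rewrite eq_sym; case: eqP => // _; last by rewrite big1.
by rewrite [in RHS]big_mkcond.
Qed.

Lemma layer_embed n (z : vec (n * M)) (f : 'I_n -> seq (vec M)) :
  (forall k, \sum_(g <- f k) g = layer z k) ->
  z = \sum_(kg <- [seq (k, g) | k <- enum 'I_n, g <- f k]) embed kg.
Proof.
move=> fE; apply/ffunP => a; rewrite big_allpairs_dep /= big_enum /= sum_ffunE.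
rewrite (bigD1 (layer_of a)) //= [X in _ + X]big1 ?addr0; last first.
  move=> k ka; rewrite sum_ffunE big1_seq // => g _.
  by rewrite ffunE /= eq_sym (negPf ka).
rewrite sum_ffunE; under eq_bigr => g _ do rewrite ffunE eqxx /=.
by rewrite -sum_ffunE fE ffunE layer_indexK.
Qed.

End Layers.

(** * Conformal pieces of bounded norm *)

Lemma form_embed M (M_gt0 : (0 < M)%N) qs (qs_dir : all (direction_of M) qs) n
    (kg : 'I_n * vec M) (j : option 'I_(size qs)) (a : 'I_(n * M)) :
  form (j, a) (embed M_gt0 kg) =
    if (if j is Some i then (nth (0%N, 0%N) qs i).2 == 0%N else false)
    then kg.2 (place_of M_gt0 a)
    else if layer_of M_gt0 a == kg.1 then form (j, place_of M_gt0 a) kg.2 else 0.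
Proof.
rewrite /form /=; case: j => [i|]; last by rewrite ffunE.
by rewrite (line_embed _ _ _ (allP qs_dir _ (mem_nth _ (ltn_ord i)))).
Qed.

Lemma form_layer M (M_gt0 : (0 < M)%N) qs (qs_dir : all (direction_of M) qs) n
    (z : vec (n * M)) (j : option 'I_(size qs)) (a : 'I_(n * M)) :
  (if j is Some i then (nth (0%N, 0%N) qs i).2 == 0%N else false) = false ->
  form (j, a) z = form (j, place_of M_gt0 a) (layer z (layer_of M_gt0 a)).
Proof.
move=> loc; rewrite {1}(layer_embed M_gt0 (z := z) (f := fun k => [:: layer z k])); last first.
  by move=> k; rewrite big_seq1.
rewrite (phi_sum (@formD qs (n * M))) big_allpairs_dep /= big_enum /=.
under eq_bigr => k _ do rewrite big_seq1 form_embed // loc /=.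
by rewrite -big_mkcond /= (big_pred1 (layer_of M_gt0 a)) // => k; rewrite eq_sym.
Qed.

Definition norm1 N (z : vec N) : nat := \sum_a `|z a|%N.

Lemma norm1D N (u v : vec N) : (norm1 (u + v)%R <= norm1 u + norm1 v)%N.
Proof. by rewrite /norm1 -big_split leq_sum // => a _; rewrite ffunE /=; lia. Qed.

Lemma norm1_embed M (M_gt0 : (0 < M)%N) n (kg : 'I_n * vec M) :
  norm1 (embed M_gt0 kg) = norm1 kg.2.
Proof.
rewrite /norm1 (sum_layers M_gt0) (bigD1 kg.1) //= [X in (_ + X)%N]big1 ?addn0; last first.
  by move=> k kk; rewrite big1 // => p _; rewrite ffunE layer_of_index (negPf kk).
by apply: eq_bigr => p _; rewrite ffunE layer_of_index eqxx place_of_index.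
Qed.

Section BoundedPiece.
Variables (M : nat) (M_gt0 : (0 < M)%N).
Variables (qs : seq (nat * nat)) (qs_dir : all (direction_of M) qs).

(** [G] plays the role of the Graver basis of one layer. *)
Lemma finite_layer_pieces : exists G : seq (vec M), (forall g, g \in G -> g != 0) /\
  forall u : vec M, exists2 gs : seq (vec M),
    (forall g, g \in gs -> g \in G /\ conformal (@form qs M) g u) & \sum_(g <- gs) g = u.
Proof.
have [G [G0 dG]] := dickson (fun (z : vec M) (eb : (option 'I_(size qs) * 'I_M) * bool) =>
    pos_part (if eb.2 then form eb.1 z else - form eb.1 z)) (enum {: _}) (fun z => z != 0).
exists G; split=> // u.
have [|gs gsP gsE] := conformal_decomposition (@formD qs M) (@form_inj qs M)
  (P := fun g => g \in G) _ u.
  move=> z /dG[g gG gz]; exists g; split=> //; first exact: G0.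
  apply/conformalP => e; apply: between_pos_part.
    exact: (gz (e, true) (mem_enum _ _)).
  exact: (gz (e, false) (mem_enum _ _)).
by exists gs => // g /gsP[].
Qed.

(** Finiteness of the Graver complexity of a layered array. Every layer of [z] is a conformal sum
    of elements of the finite set [G], so that [z] is a sum of elements of [G] placed in the
    layers. A subfamily is automatically conformal to [z] on all forms local to a layer, and it
    is conformal across the layers as soon as its total is conformal to the total of the whole
    family. Both totals and the inclusion of families depend only on the multiplicity of each
    element of [G], not on the layers; so Dickson's lemma for the vectors formed by the
    multiplicities and the total leaves finitely many minimal families, and their size bounds
    the norm whatever the number of layers. *)
Lemma bounded_conformal_piece : exists K : nat, forall n (z : vec (n * M)), z != 0 ->
  exists g, [/\ (norm1 g <= K)%N, g != 0 & conformal (@form qs (n * M)) g z].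
Proof.
have [G [G0 dG]] := finite_layer_pieces.
pose psi (l : seq (vec M)) (i : vec M + ('I_M * bool)) : nat :=
  match i with
  | inl g => count_mem g l
  | inr (p, b) => pos_part (if b then \sum_(g <- l) g p else - \sum_(g <- l) g p)
  end.
have [H [H0 dH]] := dickson psi (map inl G ++ map inr (enum {: 'I_M * bool}))
  (fun l => l != [::] /\ {subset l <= G}).
exists (\max_(l <- H) \sum_(g <- l) norm1 g)%N => n z z0.
have [f fP fE] := fin_all_exists2 (fun k : 'I_n => dG (layer z k)).
pose S := [seq (k, g) | k <- enum 'I_n, g <- f k].
have zE : z = \sum_(kg <- S) embed M_gt0 kg by exact: layer_embed fE.
have SP kg : kg \in S -> kg.2 \in f kg.1.
  by move/allpairsPdep=> [k [g [_ gf ->]]].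
have SG : {subset map snd S <= G}.
  by move=> g /mapP[kg /SP/fP[gG _] ->].
have [|l0 l0H l0P] := dH (map snd S).
  split=> //; apply: contra z0 => /eqP/(congr1 size); rewrite size_map => /size0nil.
  by move=> S0; rewrite zE S0 big_nil.
have [l0n l0G] := H0 _ l0H.
have : exists2 s, subseq s (map snd S) & perm_eq l0 s.
  apply/count_subseqP => g; have [gG|gG] := boolP (g \in G).
    by apply: (l0P (inl g)); rewrite mem_cat map_f.
  by rewrite (count_memPn _) //; apply: contra gG => /l0G.
case=> _ /subseqP[m _ ->]; rewrite -map_mask => l0S.
(* any selection from [S] with the multiplicities of [l0] will do *)
have [S2 S12] := perm_to_subseq (mask_subseq m S).
move: l0S S12; move: (mask m S) => S1 l0S S12 {m}.
have S1S kg : kg \in S1 -> kg \in S by move=> h; rewrite (perm_mem S12) mem_cat h.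
have formS e (R : seq ('I_n * vec M)) :
    @form qs _ e (\sum_(kg <- R) embed M_gt0 kg) = \sum_(kg <- R) form e (embed M_gt0 kg).
  exact: (phi_sum (@formD qs (n * M))).
have conf : conformal (@form qs (n * M)) (\sum_(kg <- S1) embed M_gt0 kg) z.
  apply/conformalP => -[j a]; rewrite formS.
  case gl: (if j is Some i then (nth (0%N, 0%N) qs i).2 == 0%N else false); last first.
    apply: (between_sub_sum S12); last by rewrite -formS -zE.
    move=> kg /SP/fP[_ /conformalP/(_ (j, place_of M_gt0 a))].
    rewrite form_embed // gl; case: eqP => [<-|_ _]; last by rewrite /between; lia.
    by rewrite -form_layer.
  under eq_bigr => kg _ do rewrite form_embed // gl.
  have -> : form (j, a) z = \sum_(kg <- S) kg.2 (place_of M_gt0 a).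
    by rewrite zE formS; apply: eq_bigr => kg _; rewrite form_embed // gl.
  rewrite -(big_map snd xpredT (fun g : vec M => g (place_of M_gt0 a))).
  rewrite -[X in between _ X](big_map snd xpredT (fun g : vec M => g (place_of M_gt0 a))).
  rewrite -(perm_big _ l0S) /=.
  apply: between_pos_part; [apply: (l0P (inr (_, true)))|apply: (l0P (inr (_, false)))];
    by rewrite mem_cat map_f ?orbT // mem_enum.
exists (\sum_(kg <- S1) embed M_gt0 kg); split=> //.
  apply: (@leq_trans (\sum_(g <- l0) norm1 g)%N); last first.
    by rewrite (big_rem l0) //= leq_maxl.
  rewrite (perm_big _ l0S) big_map /=.
  elim: (S1) => [|[k g] R IH].
    by rewrite !big_nil /norm1 big1 // => a _; rewrite ffunE.
  rewrite !big_cons; apply: leq_trans (leq_add (leqnn _) IH).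
  by apply: leq_trans (norm1D _ _) _; rewrite norm1_embed.
have [[k g] kgS1] : exists kg, kg \in S1.
  case: (S1) l0S l0n => [|kg R] l0S l0n; last by exists kg; rewrite mem_head.
  by rewrite (perm_nilP l0S) in l0n.
have /SP/fP[/G0 g0 _] := S1S _ kgS1.
apply: contra g0 => /eqP z1; apply/eqP/ffunP => p; rewrite ffunE.
have : @form qs _ (None, layer_index k p) (embed M_gt0 (k, g)) = 0.
  pose F kg := @form qs _ (None, layer_index k p) (embed M_gt0 kg).
  apply: (@between_sum_eq0 _ S1 F (@form qs _ (None, layer_index k p) z) (k, g)) => //; last first.
    by rewrite -formS z1 /form ffunE.
  move=> kg /S1S/SP/fP[_ /conformalP/(_ (None, p))].
  rewrite /F form_embed // layer_of_index place_of_index /form /= ffunE.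
  by case: eqP => [->|_ _] //; rewrite /between; lia.
by rewrite form_embed //= layer_of_index eqxx place_of_index /form.
Qed.

End BoundedPiece.

(** * The penalised objective *)

(** By convexity, increments of the same sign do not help each other. *)
Lemma abs_superadditive (I : eqType) (s : seq I) (f : I -> int) (a : int) :
  (forall i, i \in s -> between (f i) (\sum_(i <- s) f i)) ->
  \sum_(i <- s) (`|a + f i| - `|a|) <= `|a + \sum_(i <- s) f i| - `|a|.
Proof.
set z := \sum_(i <- s) f i => bs.
have [z0|z0] := lerP 0 z.
  have ps i : i \in s -> 0 <= f i by move=> /bs; rewrite /between; lia.
  rewrite /z; clear z bs z0; elim: s ps => [|i s IH] ps; first by rewrite !big_nil addr0 subrr.
  rewrite !big_cons; have {IH} := IH (fun j (h : j \in s) => ps j (mem_behead (s := i :: s) h)).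
  have : 0 <= \sum_(i <- s) f i by rewrite big_seq sumr_ge0 // => j js; apply/ps/(mem_behead (s := i :: s)).
  have := ps i (mem_head _ _); set A := \sum_(_ <- _) f _; set D := \sum_(_ <- _) (_ - _); lia.
have ps i : i \in s -> f i <= 0 by move=> /bs; rewrite /between; lia.
rewrite /z; clear z bs z0; elim: s ps => [|i s IH] ps; first by rewrite !big_nil addr0 subrr.
rewrite !big_cons; have {IH} := IH (fun j (h : j \in s) => ps j (mem_behead (s := i :: s) h)).
have : \sum_(i <- s) f i <= 0 by rewrite big_seq sumr_le0 // => j js; apply/ps/(mem_behead (s := i :: s)).
have := ps i (mem_head _ _); set A := \sum_(_ <- _) f _; set D := \sum_(_ <- _) (_ - _); lia.
Qed.

Notation dir qs j := (nth (0%N, 0%N) qs j).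

Definition cost N (w : nat -> int) (x : vec N) : int := \sum_(a < N) w a * x a.

(** Each line is counted once for each of its positions, which lets the violation be a sum over
    positions. *)
Definition defect (qs : seq (nat * nat)) N (v : nat -> nat -> int) (x : vec N) : int :=
  \sum_(a < N) (`|x a| - x a +
    \sum_(j < size qs) `|line (dir qs j) x a - v j (key (dir qs j) a)|).

Definition obj (qs : seq (nat * nat)) N w v (B : int) (x : vec N) : int :=
  cost w x + B * defect qs v x.

Section Objective.
Variables (qs : seq (nat * nat)) (N : nat).
Variables (w : nat -> int) (v : nat -> nat -> int).
Local Notation vec := (vec N).
Local Notation form := (@form qs N).
Local Notation conformal := (conformal form).

Lemma costD x y : cost w (x + y : vec) = cost w x + cost w y.
Proof. by rewrite /cost -big_split; apply: eq_bigr => a _; rewrite ffunE mulrDr. Qed.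

Lemma cost_sum (s : seq vec) : cost w (\sum_(g <- s) g) = \sum_(g <- s) cost w g.
Proof.
apply: (big_morph _ costD); rewrite /cost big1 // => a _; by rewrite ffunE mulr0.
Qed.

Lemma form_sum (e : option 'I_(size qs) * 'I_N) (s : seq vec) :
  form e (\sum_(g <- s) g) = \sum_(g <- s) form e g.
Proof. exact: (phi_sum (@formD qs N)). Qed.

Lemma defect_superadditive (x : vec) (gs : seq vec) :
  (forall g, g \in gs -> conformal g (\sum_(g <- gs) g)) ->
  \sum_(g <- gs) (defect qs v (x + g) - defect qs v x) <=
    defect qs v (x + \sum_(g <- gs) g) - defect qs v x.
Proof.
move=> gsP; set z := \sum_(g <- gs) g in gsP *.
have bf e : \sum_(g <- gs) form e g = form e z by rewrite form_sum.
have tm e c : \sum_(g <- gs) (`|form e (x + g) - c| - `|form e x - c|)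
    <= `|form e (x + z) - c| - `|form e x - c|.
  have := @abs_superadditive _ gs (fun g => form e g) (form e x - c).
  rewrite bf formD addrAC => h; apply: le_trans (h _).
    by apply: ler_sum => g _; rewrite formD addrAC.
  by move=> g /gsP/conformalP.
rewrite /defect -sumrB.
under eq_bigr => g _ do rewrite -sumrB.
rewrite exchange_big /=; apply: ler_sum => a _.
pose t (e : option 'I_(size qs) * 'I_N) c y := `|form e y - c|.
have E (g : vec) :
    `|(x + g) a| - (x + g) a + \sum_(j < size qs) `|line (dir qs j) (x + g) a - v j (key (dir qs j) a)|
    - (`|x a| - x a + \sum_(j < size qs) `|line (dir qs j) x a - v j (key (dir qs j) a)|)
   = (t (None, a) 0 (x + g) - t (None, a) 0 x) - form (None, a) g
     + \sum_(j < size qs) (t (Some j, a) (v j (key (dir qs j) a)) (x + g)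
                          - t (Some j, a) (v j (key (dir qs j) a)) x).
  by rewrite sumrB /t /form /= !subr0 ffunE; ring.
rewrite E; under eq_bigr => g _ do rewrite E.
rewrite big_split /= sumrB bf exchange_big /=.
by rewrite lerD ?lerB // ?tm // ler_sum // => j _; apply: tm.
Qed.



Lemma obj_superadditive B (x : vec) (gs : seq vec) : 0 <= B ->
  (forall g, g \in gs -> conformal g (\sum_(g <- gs) g)) ->
  \sum_(g <- gs) (obj qs w v B (x + g) - obj qs w v B x) <=
    obj qs w v B (x + \sum_(g <- gs) g) - obj qs w v B x.
Proof.
move=> B0 /(defect_superadditive x) h.
have E g : obj qs w v B (x + g) - obj qs w v B x
    = cost w g + B * (defect qs v (x + g) - defect qs v x).
  by rewrite /obj costD; ring.
rewrite E; under eq_bigr => g _ do rewrite E.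
by rewrite big_split /= -mulr_sumr -cost_sum lerD2l ler_wpM2l.
Qed.

Lemma defect_term_ge0 (x : vec) (a : 'I_N) :
  0 <= `|x a| - x a /\ 0 <= \sum_(j < size qs) `|line (dir qs j) x a - v j (key (dir qs j) a)|.
Proof. by split; [lia | apply: sumr_ge0]. Qed.

Lemma defect_ge0 (x : vec) : 0 <= defect qs v x.
Proof. by apply: sumr_ge0 => a _; have [? ?] := defect_term_ge0 x a; rewrite addr_ge0. Qed.

Lemma defect_eq0 (x : vec) : defect qs v x = 0 <->
  forall a : 'I_N, 0 <= x a /\
    forall j : 'I_(size qs), line (dir qs j) x a = v j (key (dir qs j) a).
Proof.
split=> [/eqP|h].
  rewrite psumr_eq0 => [|a _]; last by have [? ?] := defect_term_ge0 x a; rewrite addr_ge0.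
  move=> /allP h a; have := h a (mem_index_enum _); rewrite /=.
  have [t1 t2] := defect_term_ge0 x a; rewrite paddr_eq0 // => /andP[/eqP xa].
  rewrite psumr_eq0 // => /allP hj; split=> [|j]; first lia.
  by have := hj j (mem_index_enum _); rewrite /= normr_eq0 subr_eq0 => /eqP.
rewrite /defect big1 // => a _; have [xa hj] := h a.
by rewrite big1 ?addr0 => [|j _]; [lia|rewrite hj subrr].
Qed.

Lemma negative_part_le_defect (x : vec) : \sum_a (`|x a| - x a) <= defect qs v x.
Proof. by apply: ler_sum => a _; have [? ?] := defect_term_ge0 x a; rewrite lerDl. Qed.

Lemma line_gap_le_defect (x : vec) (a : 'I_N) (j : 'I_(size qs)) :
  `|line (dir qs j) x a - v j (key (dir qs j) a)| <= defect qs v x.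
Proof.
rewrite /defect (bigD1 a) //= (bigD1 j) //=.
have R : 0 <= \sum_(i < N | i != a) (`|x i| - x i +
    \sum_(j < size qs) `|line (dir qs j) x i - v j (key (dir qs j) i)|).
  by apply: sumr_ge0 => i _; have [? ?] := defect_term_ge0 x i; rewrite addr_ge0.
have R' : 0 <= \sum_(i < size qs | i != j) `|line (dir qs i) x a - v i (key (dir qs i) a)|.
  exact: sumr_ge0.
have [h _] := defect_term_ge0 x a.
by move: R R' h; set A := \sum_(i < N | _) _; set B := \sum_(i < size qs | _) _; lia.
Qed.

Lemma line_sum_le_defect0 (a : 'I_N) (j : 'I_(size qs)) :
  `|v j (key (dir qs j) a)| <= defect qs v (0 : vec).
Proof.
have := line_gap_le_defect 0 a j.
by rewrite /line big1 => [|b _]; rewrite ?ffunE // sub0r normrN.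
Qed.

(** An entry exceeds the sum of its line by at most the negative entries of that line, and this sum
    exceeds the demand by at most the defect. *)
Lemma entry_le_defect (x : vec) (a : 'I_N) : (0 < size qs)%N ->
  `|x a| <= defect qs v (0 : vec) + 3 * defect qs v x.
Proof.
move=> q0; pose j := Ordinal q0.
have := line_gap_le_defect x a j; have := line_sum_le_defect0 a j.
have := negative_part_le_defect x.
have L : x a - \sum_b (`|x b| - x b) <= line (dir qs j) x a.
  rewrite /line [X in _ <= X](bigD1 a) //= lerD2l -sumrN.
  rewrite [X in X <= _](bigID (fun b : 'I_N => (key (dir qs j) b == key (dir qs j) a) && (b != a))) /=.
  apply: ler_wnDr; first by apply: sumr_le0 => b _; lia.
  by apply: ler_sum => b _; lia.
have P : `|x a| - x a <= \sum_b (`|x b| - x b).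
  by rewrite (bigD1 a) //= lerDl sumr_ge0 // => b _; lia.
move: L P; set D := \sum_b _; set L := line _ _ _; set c := v _ _.
set D0 := defect _ _ 0; set D1 := defect _ _ x; lia.
Qed.

Lemma cost_le (x : vec) (U : int) : 0 <= U -> (forall a, `|x a| <= U) ->
  `|cost w x| <= (\sum_(a < N) `|w a|) * U.
Proof.
move=> U0 xU; rewrite mulr_suml; apply: le_trans (ler_norm_sum _ _ _) _.
by apply: ler_sum => a _; rewrite normrM ler_wpM2l.
Qed.

Definition weight_bound : int := \sum_(a < N) `|w a|.
Definition demand_bound : int := defect qs v (0 : vec).

Lemma weight_bound_ge0 : 0 <= weight_bound. Proof. exact: sumr_ge0. Qed.

(** The factor is chosen so that one unit of violation costs more than the linear
    objective can gain. *)
Definition penalty : int :=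
  2 * weight_bound * demand_bound + 3 * weight_bound + 1.

Lemma penalty_ge0 : 0 <= penalty.
Proof.
have := weight_bound_ge0; have := defect_ge0 0; rewrite /penalty -/demand_bound.
by move: weight_bound demand_bound => W V V0 W0; nia.
Qed.

Hypothesis qs_gt0 : (0 < size qs)%N.

(** Since the entries of [x] are bounded by the demands up to its defect, the penalty outweighs any
    gain in cost. *)
Lemma obj_ge (x : vec) : - (weight_bound * demand_bound) + 
   (2 * weight_bound * demand_bound + 1) * defect qs v x <= obj qs w v penalty x.
Proof.
have := cost_le _ (fun a => entry_le_defect x a qs_gt0).
rewrite -/demand_bound -/weight_bound /obj /penalty.
have := defect_ge0 x; have := defect_ge0 0; have := weight_bound_ge0; rewrite -/demand_bound.
move: weight_bound demand_bound (defect _ _ x) (cost w x) => W V D c W0 V0 D0 /(_ _)/= h.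
have : `|c| <= W * (V + 3 * D) by apply: h; lia.
by rewrite mulrDr; nia.
Qed.

Lemma obj_feasible (x : vec) : defect qs v x = 0 ->
  obj qs w v penalty x = cost w x /\ cost w x <= weight_bound * demand_bound.
Proof.
move=> D0; rewrite /obj D0 mulr0 addr0; split=> //.
have V0 : 0 <= demand_bound := defect_ge0 0.
have := cost_le V0 (fun a => _ : `|x a| <= demand_bound); rewrite -/weight_bound.
move=> h; have : `|cost w x| <= weight_bound * demand_bound.
  by apply: h => a; have := entry_le_defect x a qs_gt0; rewrite D0 mulr0 addr0.
lia.
Qed.

(** Together with [obj_feasible], the value [weight_bound * demand_bound] separates the feasible
    points from the others. *)
Lemma obj_infeasible (x : vec) : defect qs v x != 0 ->
  weight_bound * demand_bound < obj qs w v penalty x.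
Proof.
move=> D0; apply: lt_le_trans (obj_ge x); have := defect_ge0 x; have := defect_ge0 0.
have := weight_bound_ge0; rewrite -/demand_bound.
by move: weight_bound demand_bound (defect _ _ x) D0 => W V D; nia.
Qed.

Lemma obj0 B : obj qs w v B (0 : vec) = B * demand_bound.
Proof.
by rewrite /obj -/demand_bound /cost big1 ?add0r // => b _; rewrite ffunE mulr0.
Qed.

(** The search never leaves this sublevel set, so the bound limits the step lengths to be tried. *)
Lemma entry_le_sublevel (x : vec) (a : 'I_N) :
  obj qs w v penalty x <= obj qs w v penalty (0 : vec) ->
  `|x a| <= demand_bound + 3 * (penalty * demand_bound + weight_bound * demand_bound).
Proof.
move=> h; apply: le_trans (entry_le_defect x a qs_gt0) _; rewrite -/demand_bound.
have := le_trans (obj_ge x) h; rewrite obj0.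
have := defect_ge0 x; have := defect_ge0 0.
have := weight_bound_ge0; rewrite -/demand_bound.
by move: weight_bound demand_bound (defect _ _ x) penalty => W V D B; nia.
Qed.

Lemma minimizer_exists : exists y : vec, forall x : vec,
  obj qs w v penalty y <= obj qs w v penalty x.
Proof.
pose f (x : vec) := absz (obj qs w v penalty x + weight_bound * demand_bound).
have fE x : (f x)%:Z = obj qs w v penalty x + weight_bound * demand_bound.
  rewrite /f gez0_abs //; have := obj_ge x; have := defect_ge0 x; have := defect_ge0 0.
  have := weight_bound_ge0; rewrite -/demand_bound.
  by move: weight_bound demand_bound (defect _ _ x) (obj _ _ _ _ _) => W V D o; nia.
suff [y yP] : exists y, forall x, (f y <= f x)%N.
  by exists y => x; have := yP x; have := fE y; have := fE x; lia.
apply: NNPP => none; suff : forall k x, (k <= f x)%N.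
  by move=> /(_ (f 0).+1 0); rewrite ltnn.
elim=> // k IH x; rewrite ltn_neqAle IH andbT; apply/eqP => kx.
by apply: none; exists x => y; rewrite -kx.
Qed.

End Objective.

(** * A good augmenting step exists *)

(** A move adds a signed unit vector; [None] pads shorter sequences of moves to a fixed length. *)
Definition move (N : nat) : Type := option ('I_N * bool).
HB.instance Definition _ N := Finite.on (move N).

Definition unit_vec N (m : move N) : vec N :=
  if m is Some (p, b) then [ffun a => if a == p then (if b then 1 else - 1) else 0] else 0.

Definition displacement N (ms : seq (move N)) : vec N := \sum_(m <- ms) unit_vec m.

Lemma norm1_displacement N K (g : vec N) : (norm1 g <= K)%N ->
  exists ms : K.-tuple (move N), displacement ms = g.
Proof.
elim: K g => [|K IH] g gK.
  exists [tuple]; rewrite /displacement big_nil; apply/ffunP => a; rewrite ffunE.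
  by move: gK; rewrite /norm1 (bigD1 a) //=; lia.
have [g0|[p gp]] : (forall a, g a = 0) \/ exists p, g p != 0.
  case: (pickP (fun p => g p != 0)) => [p gp|g0]; first by right; exists p.
  by left=> a; have := g0 a => /negbFE/eqP.
  have [|ms msE] := IH g; first by rewrite /norm1 big1 // => a _; rewrite g0.
  by exists [tuple of None :: ms]; rewrite /displacement big_cons add0r -[RHS]msE.
pose m : move N := Some (p, 0 < g p).
have [|ms msE] := IH (g - unit_vec m).
  rewrite -ltnS; apply: leq_trans gK; rewrite /norm1 (bigD1 p) //= [X in (_ < X)%N](bigD1 p) //=.
  under eq_bigr => a ap do rewrite !ffunE (negPf ap) oppr0 addr0.
  by rewrite ltn_add2r !ffunE eqxx; move: (g p : int) gp => c; case: ltrP; lia.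
exists [tuple of m :: ms]; rewrite /displacement big_cons /=.
by rewrite -[X in _ + X]/(displacement ms) msE addrC subrK.
Qed.

Lemma not_uniq_perm (T : eqType) (s : seq T) : ~~ uniq s ->
  exists x r, perm_eq s (x :: x :: r).
Proof.
elim: s => // x s IH; rewrite /= negb_and negbK => /orP[xs|/IH[y [r sr]]].
  by exists x, (rem x s); rewrite perm_cons perm_to_rem.
exists y, (x :: r); rewrite (perm_trans (y := x :: y :: y :: r)) ?perm_cons //.
by rewrite -[x :: _]/([:: x] ++ [:: y; y] ++ r) perm_catCA.
Qed.

Section Steps.
Variables (qs : seq (nat * nat)) (N K : nat).
Local Notation vec := (vec N).
Local Notation form := (@form qs N).
Local Notation conformal := (conformal form).

Hypothesis pieces : forall z : vec, z != 0 ->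
  exists g, [/\ (norm1 g <= K)%N, g != 0 & conformal g z].

Local Notation step := (nat * K.-tuple (move N))%type.
Definition step_vec (s : step) : vec := displacement s.2 *+ 2 ^ s.1.

(** Two equal summands [2^t g] merge into [2^(t+1) g]; a shortest decomposition has none left. *)
Lemma binary_decomposition (z : vec) : exists ss : seq step,
  [/\ uniq ss, forall s, s \in ss -> displacement s.2 != 0 /\ conformal (step_vec s) z
    & \sum_(s <- ss) step_vec s = z].
Proof.
pose ok (ss : seq step) := (forall s, s \in ss ->
  displacement s.2 != 0 /\ conformal (step_vec s) z) /\ \sum_(s <- ss) step_vec s = z.
suff merge ss : ok ss -> exists ss', uniq ss' /\ ok ss'.
  have [gs gsP gsE] := conformal_decomposition (@formD qs N) (@form_inj qs N)
    (P := fun g => (norm1 g <= K)%N) pieces z.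
  suff [ss /merge[ss' [u [? ?]]]] : exists ss, ok ss by exists ss'.
  suff [ss ssP ssE] : exists2 ss : seq step, (forall s, s \in ss ->
      displacement s.2 != 0 /\ conformal (step_vec s) z) &
      \sum_(s <- ss) step_vec s = \sum_(g <- gs) g by exists ss; split; rewrite ?ssE.
  elim: gs gsP {gsE} => [|g gs IH] gsP; first by exists [::]; rewrite ?big_nil.
  have [gK g0 gz] := gsP g (mem_head _ _).
  have [ss ssP ssE] := IH (fun h hgs => gsP h (mem_behead (s := g :: gs) hgs)).
  have [ms msE] := norm1_displacement gK.
  exists ((0%N, ms) :: ss); last by rewrite !big_cons ssE /step_vec msE.
  by move=> s; rewrite inE => /orP[/eqP->|/ssP//]; rewrite /step_vec /= msE.
have [k] := ubnP (size ss); elim: k ss => // k IH ss; rewrite ltnS => ssk [ssP ssE].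
have [u|/not_uniq_perm[[t ms] [r ssr]]] := boolP (uniq ss); first by exists ss.
apply: (IH ((t.+1, ms) :: r)); first by move/perm_size: ssr ssk => /= ->.
have [ms0 _] : displacement ms != 0 /\ conformal (step_vec (t, ms)) z.
  by apply: (ssP (t, ms)); rewrite (perm_mem ssr) mem_head.
have twice : step_vec (t.+1, ms) = step_vec (t, ms) + step_vec (t, ms).
  by rewrite /step_vec /= expnS mul2n -addnn mulrnDr.
split=> [s|]; last by rewrite -ssE (perm_big _ ssr) !big_cons /= twice addrA.
rewrite inE => /orP[/eqP->|sr]; last by apply: ssP; rewrite (perm_mem ssr) !inE sr !orbT.
split=> //; apply/conformalP => e.
have -> : form e (step_vec (t.+1, ms)) = \sum_(s <- [:: (t, ms); (t, ms)]) form e (step_vec s).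
  by rewrite twice formD !big_cons big_nil addr0.
apply: (@between_sub_sum _ ss _ r); first by rewrite ssr.
  by move=> s' /ssP[_ /conformalP].
by rewrite -ssE (phi_sum (@formD qs N)).
Qed.

Variables (w : nat -> int) (v : nat -> nat -> int) (B : int).
Hypothesis B_ge0 : 0 <= B.
Local Notation obj := (obj qs w v B).

(** The difference [y - x] is a conformal sum of vectors [2^t g], and no two of them have the same
    exponent and the same moves, so that there are at most [T * (2 * N).+1 ^ K] of them. By
    superadditivity their separate gains add up to at least the gain of [y - x], hence one of
    them achieves the average. *)
Lemma improving_step (x y : vec) (T : nat) :
  (forall a, (`|y a - x a| < 2 ^ T)%N) -> obj y < obj x ->
  exists2 t, (t < T)%N & exists ms : K.-tuple (move N),
    obj x - obj y <= (T * (2 * N).+1 ^ K)%:Z * (obj x - obj (x + displacement ms *+ 2 ^ t)).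
Proof.
move=> yx lt; apply: NNPP => none.
have [ss [u ssP ssE]] := binary_decomposition (y - x).
have tT s : s \in ss -> (s.1 < T)%N.
  move=> /ssP[]; case: s => t ms /= d0 /conformalP sc.
  have [a da] : exists a, displacement ms a != 0.
    apply: NNPP => h; move/negP: d0; apply; apply/eqP/ffunP => a; rewrite ffunE.
    by apply/eqP/negbNE/negP => da; apply: h; exists a.
  have := sc (None, a); rewrite /form /= /step_vec ffunMnE !ffunE /= => b.
  rewrite -(ltn_exp2l t T (ltnSn 1)); apply: leq_ltn_trans (yx a).
  by move: b da; rewrite /between -mulr_natr natz; move: (displacement ms a) (2 ^ t)%N; nia.
have ssn : (size ss <= T * (2 * N).+1 ^ K)%N.
  have -> : (T * (2 * N).+1 ^ K)%N =
      size [seq (t, ms) | t <- iota 0 T, ms <- enum {: K.-tuple (move N)}].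
    rewrite size_allpairs size_iota -cardE card_tuple card_option card_prod card_ord card_bool.
    by rewrite (mulnC N).
  apply: uniq_leq_size => // -[t ms] /tT /= tT'; apply/allpairsP; exists (t, ms).
  by rewrite mem_iota mem_enum.
set R := (T * _)%N in none ssn.
have sup := @obj_superadditive qs N w v B x (map step_vec ss) B_ge0.
rewrite !big_map ssE (_ : x + (y - x) = y) in sup; last by rewrite addrC subrK.
have {}sup : obj x - obj y <= \sum_(s <- ss) (obj x - obj (x + step_vec s)).
  rewrite -lerN2 opprB -sumrN; under eq_bigr => s _ do rewrite opprB.
  by apply: sup => _ /mapP[s /ssP[_ sc] ->].
have each s : s \in ss -> R%:Z * (obj x - obj (x + step_vec s)) <= obj x - obj y - 1.
  move=> sss; rewrite -ltzD1 subrK ltNge; apply/negP => h; apply: none.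
  by exists s.1; [exact: tT | exists s.2].
have : R%:Z * (obj x - obj y) <= (size ss)%:Z * (obj x - obj y - 1).
  apply: le_trans (ler_wpM2l _ sup) _ => //; rewrite mulr_sumr.
  elim: (ss) each => [|s r IH] each; first by rewrite big_nil mul0r.
  rewrite big_cons /= -addn1 PoszD mulrDl mul1r addrC lerD // ?each ?mem_head //.
  by apply: IH => s' s'r; apply: each; rewrite inE s'r orbT.
have D0 : 0 < obj x - obj y by rewrite subr_gt0.
case: (posnP R) ssn => [R0|R0] ssn; last by move: ssn D0; move: (obj x - obj y) (size ss); nia.
move: sup; rewrite (size0nil (s := ss)) ?big_nil; lia.
Qed.


End Steps.

(** * Bit costs from step counts *)

(** Unit-cost counterpart of [exec]; the bit costs are recovered from it in [runs_cost]. *)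
Inductive runs : prog -> store -> nat -> store -> Prop :=
  | runs_skip s : runs Skip s 1 s
  | runs_put s k e1 e2 : runs (Put k e1 e2) s 1 (upd s k (eval s e1) (eval s e2))
  | runs_seq c1 c2 s s1 s2 t1 t2 :
      runs c1 s t1 s1 -> runs c2 s1 t2 s2 -> runs (Seq c1 c2) s (t1 + t2) s2
  | runs_if_true e c1 c2 s s1 t :
      eval s e != 0 -> runs c1 s t s1 -> runs (If e c1 c2) s t.+1 s1
  | runs_if_false e c1 c2 s s1 t :
      eval s e = 0 -> runs c2 s t s1 -> runs (If e c1 c2) s t.+1 s1
  | runs_while_false e c s : eval s e = 0 -> runs (While e c) s 1 s
  | runs_while_true e c s s1 s2 t1 t2 :
      eval s e != 0 -> runs c s t1 s1 -> runs (While e c) s1 t2 s2 ->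
      runs (While e c) s (t1 + t2).+1 s2.

Fixpoint esize (e : expr) : nat :=
  match e with
  | Cst z => bitlen z
  | Get _ e1 => (esize e1).+1
  | Bin _ e1 e2 => (esize e1 + esize e2).+1
  end.

Fixpoint psize (c : prog) : nat :=
  match c with
  | Skip => 0
  | Put _ e1 e2 => esize e1 + esize e2
  | Seq c1 c2 => psize c1 + psize c2
  | If e c1 c2 => esize e + psize c1 + psize c2
  | While e c1 => esize e + psize c1
  end.

Section Linear.
Variable fixed : pred nat.

(** Degree in the cells of the arrays that are not [fixed]: the value of an expression of degree 0
    has a length bounded in terms of the fixed arrays, one of degree 1 adds this much to the
    length of a changing cell. An address may be of degree 1, and a comparison yields a bit
    whatever it compares. *)
Fixpoint degree (e : expr) : nat :=
  match e with
  | Cst _ => 0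
  | Get k e1 => if (degree e1 <= 1)%N then (if fixed k then 0 else 1) else 2
  | Bin Mul e1 e2 => degree e1 + degree e2
  | Bin Leq e1 e2 => if (maxn (degree e1) (degree e2) <= 1)%N then 0 else 2
  | Bin _ e1 e2 => maxn (degree e1) (degree e2)
  end.

Fixpoint linear (c : prog) : bool :=
  match c with
  | Skip => true
  | Put k e1 e2 => [&& ~~ fixed k, degree e1 <= 1 & degree e2 <= 1]%N
  | Seq c1 c2 => linear c1 && linear c2
  | If e c1 c2 => [&& degree e <= 1, linear c1 & linear c2]%N
  | While e c1 => (degree e <= 1)%N && linear c1
  end.

Definition fits (s : store) (P : pred nat) (b : nat) : Prop :=
  forall k a, P k -> (`|s k a| <= 2 ^ b)%N.

Lemma bitlen_le z b : (`|z| <= 2 ^ b)%N -> (bitlen z <= b.+2)%N.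
Proof.
move=> zb; rewrite /bitlen ltnS up_log_min // expnS.
by have := expn_gt0 2 b; lia.
Qed.

Lemma absz_lt_exp_bitlen z : (`|z| < 2 ^ bitlen z)%N.
Proof.
have := up_logP `|z|.+1 (ltnSn 1); rewrite /bitlen expnS => h.
by have := expn_gt0 2 (up_log 2 `|z|.+1); lia.
Qed.

Lemma absz_div_le a b : (`|(a %/ b)%Z| <= `|a|)%N.
Proof.
have [->|b0] := eqVneq b 0; first by rewrite divz0.
have sb : `|sgz b|%N = 1%N by rewrite /sgz (negPf b0); case: ifP.
case: a => m; rewrite /divz abszM sb mul1n /= ?abszN /= ?ltnS leq_div //.
Qed.

Lemma binop_le_exp o a b (x y z : nat) : o <> Mul ->
  (`|a| <= 2 ^ x)%N -> (`|b| <= 2 ^ y)%N -> (maxn x y < z)%N ->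
  (`|binop_eval o a b| <= 2 ^ z)%N.
Proof.
move=> oM ax bY xyz.
have zz : (2 ^ x + 2 ^ y <= 2 ^ z)%N.
  apply: leq_trans (leq_pexp2l (ltn0Sn 1) xyz); rewrite expnS mul2n -addnn.
  by rewrite leq_add // leq_pexp2l // ?leq_maxl ?leq_maxr.
have := absz_div_le a b; have := expn_gt0 2 x.
by case: o oM => //= _; last (case: ifP); lia.
Qed.

Lemma eval_fits s b0 b e : (0 < b0)%N -> fits s fixed b0 -> fits s predT b ->
  (degree e <= 1)%N -> (`|eval s e| <= 2 ^ (b0 * esize e + degree e * b))%N.
Proof.
move=> b0_gt0 s0 sb; elim: e => [z|k e IH|o e1 IH1 e2 IH2].
- move=> _ /=; apply: leq_trans (ltnW (absz_lt_exp_bitlen z)) _.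
  by rewrite leq_pexp2l //; nia.
- move=> /=; case: ifP => // d1; case: ifP => fk _.
    by apply: leq_trans (s0 _ _ fk) _; rewrite leq_pexp2l //; nia.
  by apply: leq_trans (sb _ _ isT) _; rewrite leq_pexp2l //; nia.
have [->|oM] : o = Mul \/ o <> Mul by case: o; [right|right|left|right|right].
  move=> /= d; have {}IH1 := IH1 ltac:(lia); have {}IH2 := IH2 ltac:(lia).
  rewrite abszM; apply: leq_trans (leq_mul IH1 IH2) _; rewrite -expnD leq_pexp2l //; nia.
move=> d; have d12 : (maxn (degree e1) (degree e2) <= 1)%N.
  by case: o oM d => //=; case: ifP.
have {}IH1 := IH1 ltac:(lia); have {}IH2 := IH2 ltac:(lia).
have [oL|oL] : o = Leq \/ o <> Leq by clear; case: o; [right|right|right|right|left].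
  by rewrite oL; apply: (@leq_trans 1); rewrite ?expn_gt0 //=; case: ifP.
have -> : degree (Bin o e1 e2) = maxn (degree e1) (degree e2) by case: o oM oL d.
rewrite [eval _ _]/= [esize _]/=.
apply: (binop_le_exp oM IH1 IH2); rewrite gtn_max; apply/andP; split; nia.
Qed.

Lemma ecost_le s b0 b e beta : (0 < b0)%N -> fits s fixed b0 -> fits s predT b ->
  (degree e <= 1)%N -> (b0 * esize e + b + 2 <= beta)%N -> (ecost s e <= 3 * esize e * beta)%N.
Proof.
move=> b0_gt0 s0 sb; have ev e' : (degree e' <= 1)%N -> (b0 * esize e' + b + 2 <= beta)%N ->
    (bitlen (eval s e') <= beta)%N.
  move=> d; apply: leq_trans; apply: leq_trans (bitlen_le (eval_fits b0_gt0 s0 sb d)) _; nia.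
elim: e => [z|k e IH|o e1 IH1 e2 IH2] d be.
- by rewrite /=; nia.
- have := ev _ d be; move: d be => /=; case: ifP => // d1 _ be ?.
  by have := IH d1 ltac:(nia); have := ev _ d1 ltac:(nia); nia.
have [d1 d2] : (degree e1 <= 1)%N /\ (degree e2 <= 1)%N.
  by clear be; move: d => /=; case: o; try lia; case: ifP => //; lia.
have := ev _ d be; move: be => /= be.
have := IH1 d1 ltac:(nia); have := IH2 d2 ltac:(nia).
have := ev _ d1 ltac:(nia); have := ev _ d2 ltac:(nia); nia.
Qed.

(** Along a linear program the longest cell grows by a bounded number of bits per step,
    because no product has two factors of degree 1. *)
Lemma runs_exec_le c s tau s' (b0 b C : nat) : runs c s tau s' -> linear c -> (psize c <= C)%N ->
  (0 < b0)%N -> fits s fixed b0 -> fits s predT b ->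
  [/\ fits s' fixed b0, fits s' predT (b + tau * (b0 * C))
    & forall beta, (b + tau * (b0 * C) + b0 * C + 2 <= beta)%N ->
        exists2 t, exec c s t s' & (t <= tau * (8 * C + 2) * beta)%N].
Proof.
move=> run; elim: run b => {c s tau s'}
  [s|s k e1 e2|c1 c2 s s1 s2 t1 t2 _ IH1 _ IH2|e c1 c2 s s1 t e0 _ IH|e c1 c2 s s1 t e0 _ IH
  |e c s e0|e c s s1 s2 t1 t2 e0 _ IH1 _ IH2] b /=.
- move=> _ _ b0_gt0 s0 sb; split=> // [k a _|beta bb].
    by apply: leq_trans (sb k a isT) _; rewrite leq_pexp2l // leq_addr.
  by exists 1%N; [apply: exec_skip | nia].
- move=> /and3P[fk d1 d2] C12 b0_gt0 s0 sb.
  have e1C : (b0 * esize e1 <= b0 * C)%N by rewrite leq_mul2l; lia.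
  have e2C : (b0 * esize e2 <= b0 * C)%N by rewrite leq_mul2l; lia.
  split=> [k' a fk'|k' a _|beta bb].
  + rewrite /upd; case: eqP => [kk|_] /=; last exact: s0.
    by rewrite kk (negPf fk) in fk'.
  + rewrite /upd; case: ifP => _.
      apply: leq_trans (eval_fits b0_gt0 s0 sb d2) _; rewrite leq_pexp2l //; nia.
    by apply: leq_trans (sb k' a isT) _; rewrite leq_pexp2l // leq_addr.
  eexists; first exact: exec_put.
  have := ecost_le (beta := beta) b0_gt0 s0 sb d1 ltac:(lia).
  have := ecost_le (beta := beta) b0_gt0 s0 sb d2 ltac:(lia).
  have := bitlen_le (eval_fits b0_gt0 s0 sb d1); have := bitlen_le (eval_fits b0_gt0 s0 sb d2).
  have : (degree e1 * b <= b)%N by nia.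
  have : (degree e2 * b <= b)%N by nia.
  have : (esize e1 * beta + esize e2 * beta <= C * beta)%N by rewrite -mulnDl leq_mul2r C12 orbT.
  lia.
- move=> /andP[l1 l2] C12 b0_gt0 s0 sb.
  have [s10 s1b x1] := IH1 b l1 ltac:(lia) b0_gt0 s0 sb.
  have [s20 s2b x2] := IH2 _ l2 ltac:(lia) b0_gt0 s10 s1b.
  split=> // [|beta bb]; first by move: s2b; rewrite -addnA -mulnDl.
  have [u1 r1 h1] := x1 beta ltac:(nia); have [u2 r2 h2] := x2 beta ltac:(nia).
  by exists (u1 + u2)%N; [apply: exec_seq r1 r2 | rewrite !mulnDl leq_add].
- move=> /and3P[d l1 l2] C12 b0_gt0 s0 sb.
  have [s10 s1b x1] := IH b l1 ltac:(lia) b0_gt0 s0 sb.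
  split=> // [k a h|beta bb].
    by apply: leq_trans (s1b k a h) _; rewrite leq_pexp2l //; nia.
  have [u1 r1 h1] := x1 beta ltac:(nia).
  have eC : (b0 * esize e <= b0 * C)%N by rewrite leq_mul2l; lia.
  have := ecost_le (beta := beta) b0_gt0 s0 sb d ltac:(nia).
  have : (esize e * beta <= C * beta)%N by rewrite leq_mul2r; lia.
  by exists (ecost s e + u1)%N; [apply: exec_if_true | nia].
- move=> /and3P[d l1 l2] C12 b0_gt0 s0 sb.
  have [s10 s1b x1] := IH b l2 ltac:(lia) b0_gt0 s0 sb.
  split=> // [k a h|beta bb].
    by apply: leq_trans (s1b k a h) _; rewrite leq_pexp2l //; nia.
  have [u1 r1 h1] := x1 beta ltac:(nia).
  have eC : (b0 * esize e <= b0 * C)%N by rewrite leq_mul2l; lia.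
  have := ecost_le (beta := beta) b0_gt0 s0 sb d ltac:(nia).
  have : (esize e * beta <= C * beta)%N by rewrite leq_mul2r; lia.
  by exists (ecost s e + u1)%N; [apply: exec_if_false | nia].
- move=> /andP[d l] C12 b0_gt0 s0 sb; split=> // [k a _|beta bb].
    by apply: leq_trans (sb k a isT) _; rewrite leq_pexp2l // leq_addr.
  have eC : (b0 * esize e <= b0 * C)%N by rewrite leq_mul2l; lia.
  have := ecost_le (beta := beta) b0_gt0 s0 sb d ltac:(nia).
  have : (esize e * beta <= C * beta)%N by rewrite leq_mul2r; lia.
  by exists (ecost s e); [apply: exec_while_false | nia].
move=> /andP[d l] C12 b0_gt0 s0 sb.
have [s10 s1b x1] := IH1 b l ltac:(lia) b0_gt0 s0 sb.
have [s20 s2b x2] := IH2 _ ltac:(by rewrite /= d l) C12 b0_gt0 s10 s1b.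
split=> // [k a h|beta bb].
  by apply: leq_trans (s2b k a h) _; rewrite leq_pexp2l //; nia.
have [u1 r1 h1] := x1 beta ltac:(nia); have [u2 r2 h2] := x2 beta ltac:(nia).
have eC : (b0 * esize e <= b0 * C)%N by rewrite leq_mul2l; lia.
have := ecost_le (beta := beta) b0_gt0 s0 sb d ltac:(nia).
have : (esize e * beta <= C * beta)%N by rewrite leq_mul2r; lia.
by exists (ecost s e + u1 + u2)%N; [apply: exec_while_true r1 r2 | nia].
Qed.

End Linear.

Lemma runs_cost fixed c s tau s' b : runs c s tau s' -> linear fixed c -> (0 < b)%N ->
  fits s predT b ->
  fits s' predT (b * (tau * psize c).+1) /\
  exists2 t, exec c s t s' &
    (t <= tau * (8 * psize c + 2) * (b * (tau.+1 * psize c).+1 + 2))%N.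
Proof.
move=> r l b0 sb.
have [_ h x] := runs_exec_le r l (leqnn _) b0 (fun k a _ => sb k a isT) sb.
split=> [k a _|]; first by apply: leq_trans (h k a isT) _; rewrite leq_pexp2l //; nia.
by have [|t e te] := x (b * (tau.+1 * psize c).+1 + 2)%N; [nia | exists t].
Qed.

(** * Counting steps of structured programs *)

Definition does (c : prog) (s : store) (tau : nat) (Q : store -> Prop) : Prop :=
  exists t s', [/\ runs c s t s', (t <= tau)%N & Q s'].

Lemma does_le c s tau tau' (Q Q' : store -> Prop) : does c s tau Q -> (tau <= tau')%N ->
  (forall s', Q s' -> Q' s') -> does c s tau' Q'.
Proof.
move=> [t [s' [r tt q]]] le QQ; exists t, s'; split; [done|exact: leq_trans le|exact: QQ].
Qed.

Lemma does_skip s (Q : store -> Prop) : Q s -> does Skip s 1 Q.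
Proof. by exists 1%N, s; split=> //; apply: runs_skip. Qed.

Lemma does_put s k e1 e2 (Q : store -> Prop) :
  Q (upd s k (eval s e1) (eval s e2)) -> does (Put k e1 e2) s 1 Q.
Proof. by eexists 1%N, _; split; [apply: runs_put| |]. Qed.

Lemma does_seq c1 c2 s t1 t2 (Q : store -> Prop) :
  does c1 s t1 (fun s1 => does c2 s1 t2 Q) -> does (Seq c1 c2) s (t1 + t2) Q.
Proof.
case=> u1 [s1 [r1 h1 [u2 [s2 [r2 h2 q]]]]].
by exists (u1 + u2)%N, s2; split=> //; [apply: runs_seq r1 r2 | apply: leq_add].
Qed.

Lemma does_if e c1 c2 s t (Q : store -> Prop) :
  (eval s e != 0 -> does c1 s t Q) -> (eval s e = 0 -> does c2 s t Q) ->
  does (If e c1 c2) s t.+1 Q.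
Proof.
move=> h1 h2; have [e0|e0] := eqVneq (eval s e) 0.
  have [u [s' [r le q]]] := h2 e0.
  by exists u.+1, s'; split=> //; apply: runs_if_false.
have [u [s' [r le q]]] := h1 e0.
by exists u.+1, s'; split=> //; apply: runs_if_true.
Qed.

Lemma does_while e c (Inv : nat -> store -> Prop) tau :
  (forall k s, Inv k s -> eval s e != 0 -> exists2 k', k = k'.+1 & does c s tau (Inv k')) ->
  forall k s, Inv k s ->
  does (While e c) s (k * tau.+1).+1 (fun s' => eval s' e = 0 /\ exists k', Inv k' s').
Proof.
move=> body; elim/ltn_ind=> k IH s Is; have [e0|e0] := eqVneq (eval s e) 0.
  exists 1%N, s; split=> //; first exact: runs_while_false.
  by split=> //; exists k.
have [k' kk [u [s1 [r1 h1 I1]]]] := body _ _ Is e0.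
have [u2 [s2 [r2 h2 q]]] := IH k' ltac:(by rewrite kk) _ I1.
by exists (u + u2).+1, s2; split=> //; [apply: runs_while_true r1 r2 | rewrite kk; lia].
Qed.

Fixpoint writes (S : pred nat) (c : prog) : bool :=
  match c with
  | Skip => true
  | Put k _ _ => S k
  | Seq c1 c2 => writes S c1 && writes S c2
  | If _ c1 c2 => writes S c1 && writes S c2
  | While _ c1 => writes S c1
  end.

Lemma writes_sub (S S' : pred nat) c : {subset S <= S'} -> writes S c -> writes S' c.
Proof.
move=> sub; elim: c => //= [k _ _|c1 IH1 c2 IH2|_ c1 IH1 c2 IH2]; first exact: sub.
  by case/andP=> /IH1-> /IH2->.
by case/andP=> /IH1-> /IH2->.
Qed.

Definition agree (S : pred nat) (s s' : store) : Prop := forall k a, ~~ S k -> s' k a = s k a.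

Lemma agree_trans S s1 s2 s3 : agree S s1 s2 -> agree S s2 s3 -> agree S s1 s3.
Proof. by move=> h1 h2 k a Sk; rewrite h2 // h1. Qed.

Lemma agree_sub (S S' : pred nat) s s' : {subset S <= S'} -> agree S s s' -> agree S' s s'.
Proof. by move=> sub h k a Sk; apply: h; apply: contra Sk; apply: sub. Qed.

Lemma runs_agree S c s t s' : runs c s t s' -> writes S c -> agree S s s'.
Proof.
elim=> {c s t s'} //=.
- by move=> s k e1 e2 Sk k' a Sk'; rewrite /upd; case: eqP => //= kk; rewrite kk Sk in Sk'.
- by move=> c1 c2 s s1 s2 t1 t2 _ IH1 _ IH2 /andP[/IH1 h1 /IH2 h2]; apply: agree_trans h1 h2.
- by move=> e c1 c2 s s1 t _ _ IH /andP[/IH].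
- by move=> e c1 c2 s s1 t _ _ IH /andP[_ /IH].
by move=> e c s s1 s2 t1 t2 _ _ IH1 _ IH2 w; apply: agree_trans (IH1 w) (IH2 w).
Qed.

Lemma does_agree S c s tau Q : writes S c -> does c s tau Q ->
  does c s tau (fun s' => agree S s s' /\ Q s').
Proof.
move=> w [t [s' [r h q]]]; exists t, s'; split=> //; split=> //; exact: runs_agree r w.
Qed.

Section Names.
Variable o : nat.

(** The arrays below [o] hold the input, so the working arrays are named by their offset from [o];
    whether two of them differ is then decided by computation, although [o] is a variable. *)
Definition touched (I : seq nat) (k : nat) : bool := (o <= k)%N && ((k - o)%N \in I).

Lemma touchedD I i : touched I (o + i) = (i \in I).
Proof. by rewrite /touched leq_addr addKn. Qed.

Lemma touched_lt I k : (k < o)%N -> touched I k = false.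
Proof. by move=> ko; rewrite /touched leqNgt ko. Qed.

Lemma touched_sub I J : {subset I <= J} -> {subset touched I <= touched J}.
Proof. by move=> sub k; rewrite !unfold_in => /andP[-> /sub]. Qed.

Lemma updD s i a z j b :
  upd s (o + i) a z (o + j) b = if (j == i) && (b == a) then z else s (o + j)%N b.
Proof. by rewrite /upd eqn_add2l. Qed.

Lemma upd_lt s i a z k b : (k < o)%N -> upd s (o + i) a z k b = s k b.
Proof. by rewrite /upd; case: eqP => //= ->; rewrite ltnNge leq_addr. Qed.

Lemma agree_upd I i s a z : i \in I -> agree (touched I) s (upd s (o + i) a z).
Proof.
move=> iI k b; rewrite /upd; case: eqP => //= ->.
by rewrite touchedD iI.
Qed.

Definition var i := Get (o + i) (Cst 0).
Definition set i e := Put (o + i) (Cst 0) e.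

Definition for_loop (i : nat) (body : prog) : prog :=
  Seq (set i (Cst 0))
    (While (Bin Leq (Bin Add (var i) (Cst 1)) (var 0))
       (Seq body (set i (Bin Add (var i) (Cst 1))))).

(** The invariant speaks of the number of completed passes and not of the loop counter, hence its
    stability under assignments to the counter. *)
Lemma does_for_loop (S : pred nat) i body s0 N tau (Inv : nat -> store -> Prop) :
  writes S body -> ~~ S (o + i)%N -> ~~ S (o + 0)%N -> i != 0%N ->
  s0 (o + 0)%N 0 = N%:Z ->
  (forall j s z, Inv j s -> Inv j (upd s (o + i) 0 z)) ->
  Inv 0 s0 ->
  (forall (j : nat) s, (j < N)%N -> agree (predU1 (o + i)%N S) s0 s ->
     s (o + i)%N 0 = j%:Z -> Inv j s -> does body s tau (Inv j.+1)) ->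
  does (for_loop i body) s0 (N * tau.+2 + 2)
    (fun s => agree (predU1 (o + i)%N S) s0 s /\ Inv N s).
Proof.
move=> wb iS zS i0 sN stable I0 step.
have -> : (N * tau.+2 + 2 = 1 + (N * tau.+2).+1)%N by lia.
apply/does_seq/does_put => /=.
set s1 := upd _ _ _ _.
have ag_upd s z : agree (predU1 (o + i)%N S) s (upd s (o + i) 0 z).
  by move=> k a; rewrite /upd /= negb_or => /andP[/negPf-> _].
pose J (k : nat) s := exists j : nat, [/\ (j + k = N)%N, agree (predU1 (o + i)%N S) s0 s,
  s (o + i)%N 0 = j%:Z & Inv j s].
have n0 (s : store) : agree (predU1 (o + i)%N S) s0 s -> s (o + 0)%N 0 = N%:Z.
  by move=> h; rewrite h //= negb_or zS andbT eqn_add2l eq_sym.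
pose test := Bin Leq (Bin Add (var i) (Cst 1)) (var 0).
pose next := Seq body (set i (Bin Add (var i) (Cst 1))).
have Jstep k s : J k s -> eval s test != 0 -> exists2 k', k = k'.+1 & does next s tau.+1 (J k').
  move=> [j [jk ag sj Ij]] /=; rewrite sj n0 //; case: k jk => [|k] jk.
    by rewrite addn0 in jk; rewrite jk; case: ifP => //; lia.
  move=> _; exists k => //; rewrite -addn1; apply: does_seq.
  have [|t [s' [r h [ag' Ij']]]] := does_agree wb (step j s _ ag sj Ij); first lia.
  exists t, s'; split=> //; apply: does_put => /=; exists j.+1; split=> //=; first lia.
  + apply: agree_trans ag _; apply: agree_trans (agree_sub _ ag') _; last exact: ag_upd.
    by move=> x xS; rewrite !unfold_in /= [S x]xS orbT.
  + by rewrite updD !eqxx /= ag' // sj; lia.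
  exact: stable.
have J0 : J N s1.
  by exists 0%N; split=> //; [exact: ag_upd | rewrite /s1 updD !eqxx | exact: stable].
have [t [s' [r h [e0 [k' [j [jk ag sj Ij]]]]]]] := does_while Jstep J0.
exists t, s'; split=> //.
split=> //; move: e0 Ij => /=; rewrite sj n0 //.
have [->//|jN] : j = N \/ (j < N)%N by lia.
by case: ifP => //; lia.
Qed.

Lemma does_for I i body s0 N tau (Inv : nat -> store -> Prop) :
  writes (touched I) body -> (i \notin I) && (0%N \notin I) -> i != 0%N ->
  s0 (o + 0)%N 0 = N%:Z ->
  (forall j s z, Inv j s -> Inv j (upd s (o + i) 0 z)) ->
  Inv 0 s0 ->
  (forall (j : nat) s, (j < N)%N -> agree (touched (i :: I)) s0 s -> s (o + i)%N 0 = j%:Z ->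
     Inv j s -> does body s tau (Inv j.+1)) ->
  does (for_loop i body) s0 (N * tau.+2 + 2) (fun s => agree (touched (i :: I)) s0 s /\ Inv N s).
Proof.
move=> wb /andP[iI zI] i0 sN stable I0 step.
have sub : {subset predU1 (o + i)%N (touched I) <= touched (i :: I)}.
  move=> k /predU1P kS; rewrite -[_ \in _]/(touched (i :: I) k).
  case: kS => [->|/andP[ok kI]]; first by rewrite touchedD mem_head.
  by rewrite /touched ok inE kI orbT.
have iS : ~~ touched I (o + i) by rewrite touchedD.
have zS : ~~ touched I (o + 0) by rewrite touchedD.
have [|t [s' [r h [ag IN]]]] := does_for_loop wb iS zS i0 sN stable I0 (tau := tau).
  by move=> j s jN ag; apply: step => //; apply: agree_sub sub ag.
by exists t, s'; split=> //; split=> //; apply: agree_sub sub ag.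
Qed.

End Names.

(** * The local search program *)

(* Offsets of the working arrays. Scalars sit in cell 0 of their array. The arrays before [nX] are
   constant during the search. *)
Notation nN := 0%N.
Notation nPen := 1%N.
Notation nMax := 2%N.
Notation nWgt := 3%N.
Notation nX := 4%N.
Notation nBestX := 5%N.
Notation nAcc := 6%N.
Notation nSum := 7%N.
Notation nI := 8%N.
Notation nJ := 9%N.
Notation nBest := 10%N.
Notation nFlag := 11%N.
Notation nStep := 12%N.
Notation nMove k := (13 + k)%N.

Lemma does_bind c1 c2 s t1 t2 (Q1 Q : store -> Prop) : does c1 s t1 Q1 ->
  (forall s1, Q1 s1 -> does c2 s1 t2 Q) -> does (Seq c1 c2) s (t1 + t2) Q.
Proof. by move=> h1 h2; apply: does_seq; apply: does_le h1 _ h2. Qed.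

Definition key_expr (q : nat * nat) (e : expr) : expr :=
  Bin Add (Bin Sub e (Bin Mul (Cst q.1) (Bin Quo e (Cst q.1))))
          (Bin Mul (Cst q.1) (Bin Quo e (Cst q.2))).

Definition abs_expr (e : expr) : expr :=
  Bin Mul (Bin Sub (Cst 1) (Bin Mul (Cst 2) (Bin Leq e (Cst 0)))) e.

Lemma eval_key q e s (a : nat) : eval s e = a%:Z -> eval s (key_expr q e) = (key q a)%:Z.
Proof.
move=> /= ->; rewrite !divz_nat /key; have := divn_eq a q.1.
by move: (a %/ q.1)%N (a %% q.1)%N (a %/ q.2)%N => x y z; nia.
Qed.

Lemma eval_abs e s : eval s (abs_expr e) = `|eval s e|.
Proof. by rewrite /=; case: (lerP (eval s e) 0); lia. Qed.

Section Program.
Variables (o : nat) (qs : seq (nat * nat)).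
Hypothesis o_large : (size qs + 2 <= o)%N.

Local Notation var := (var o).
Local Notation set := (set o).
Local Notation for_loop := (for_loop o).
Local Notation touched := (touched o).
Local Notation cell s i := ((s : store) (o + i)%N 0).

Definition copy_loop (src dst : nat) : prog :=
  for_loop nI (Put (o + dst) (var nI) (Get (o + src) (var nI))).

Definition line_loop (q : nat * nat) : prog :=
  Seq (set nSum (Cst 0))
    (for_loop nJ (If (Bin Sub (key_expr q (var nJ)) (key_expr q (var nI))) Skip
       (set nSum (Bin Add (var nSum) (Get (o + nX) (var nJ)))))).

Definition direction_test (j : nat) (q : nat * nat) : prog :=
  Seq (line_loop q)
    (set nAcc (Bin Add (var nAcc) (Bin Mul (var nPen)
       (abs_expr (Bin Sub (var nSum) (Get j.+2 (key_expr q (var nI)))))))).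

Fixpoint direction_tests (j : nat) (qs : seq (nat * nat)) : prog :=
  if qs is q :: qs' then Seq (direction_test j q) (direction_tests j.+1 qs') else Skip.

Definition objective_body : prog :=
  Seq (set nAcc (Bin Add (var nAcc) (Bin Add
        (Bin Mul (Get 1 (var nI)) (Get (o + nX) (var nI)))
        (Bin Mul (var nPen) (Bin Sub (abs_expr (Get (o + nX) (var nI)))
                                     (Get (o + nX) (var nI)))))))
      (direction_tests 0 qs).

Definition objective : prog := Seq (set nAcc (Cst 0)) (for_loop nI objective_body).

Definition compare : prog :=
  Seq objective
    (If (Bin Leq (Bin Add (var nAcc) (Cst 1)) (var nBest))
       (Seq (set nBest (var nAcc)) (Seq (set nFlag (Cst 1)) (copy_loop nX nBestX)))
       Skip).

Definition shift (k : nat) (z : int) : prog :=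
  Put (o + nX) (var (nMove k))
    (Bin Add (Get (o + nX) (var (nMove k))) (Bin Mul (Cst z) (var nStep))).

Fixpoint explore (k : nat) : prog :=
  if k is k'.+1 then
    Seq (explore k') (for_loop (nMove k')
      (Seq (shift k' 1) (Seq (explore k') (Seq (shift k' (-2)) (Seq (explore k') (shift k' 1))))))
  else compare.

Definition vec_at N (s : store) (i : nat) : vec N := [ffun a : 'I_N => s (o + i)%N (a : nat)%:Z].

Lemma does_copy N s src dst : cell s nN = N%:Z ->
  src != nI -> dst != nI -> dst != nN -> src != dst ->
  does (copy_loop src dst) s (N * 3 + 2)
    (fun s' => agree (touched [:: nI; dst]) s s' /\ vec_at N s' dst = vec_at N s src).
Proof.
move=> sN si di dn sd.
have := @does_for o [:: dst] nI (Put (o + dst) (var nI) (Get (o + src) (var nI))) s N 1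
  (fun j s' => forall b : nat, (b < j)%N -> s' (o + dst)%N b%:Z = s (o + src)%N b%:Z).
case=> //.
- by rewrite /= touchedD mem_head.
- by rewrite !inE ![_ == dst]eq_sym di dn.
- by move=> j s1 z h b bj; rewrite updD (negPf di) /= h.
- move=> j s1 jN ag sj h; apply: does_put => b; rewrite ltnS updD eqxx /= sj eqz_nat.
  have [->|bj] := eqVneq b j; first by rewrite ag // touchedD !inE negb_or si.
  by rewrite leq_eqVlt (negPf bj) => /h.
move=> t [s' [r le [ag h]]]; exists t, s'; split=> //; split=> //.
by apply/ffunP => a; rewrite !ffunE h.
Qed.

Lemma does_line_loop N s q (a : nat) : cell s nN = N%:Z -> cell s nI = a%:Z ->
  does (line_loop q) s (N * 4 + 3)
    (fun s' => agree (touched [:: nJ; nSum]) s s' /\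
               cell s' nSum = line q (vec_at N s nX) a).
Proof.
move=> sN sa; rewrite (_ : (N * 4 + 3 = 1 + (N * 4 + 2))%N); last lia.
apply/does_seq/does_put => /=; set s1 := upd _ _ _ _.
have := @does_for o [:: nSum] nJ (If (Bin Sub (key_expr q (var nJ)) (key_expr q (var nI))) Skip
       (set nSum (Bin Add (var nSum) (Get (o + nX) (var nJ))))) s1 N 2
  (fun j s' => cell s' nSum =
     \sum_(b < j) if key q b == key q a then s (o + nX)%N (b : nat)%:Z else 0).
case=> //.
- by rewrite /= touchedD mem_head.
- by rewrite /s1 updD.
- by move=> j s2 z h; rewrite updD.
- by rewrite /s1 updD /= big_ord0.
- move=> j s2 jN ag sj h.
  have s2I : eval s2 (var nI) = a%:Z by rewrite /= ag ?touchedD //= /s1 updD.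
  have test : (eval s2 (Bin Sub (key_expr q (var nJ)) (key_expr q (var nI))) == 0)
      = (key q j == key q a).
    by rewrite -[RHS]eqz_nat -[RHS]subr_eq0 -(eval_key q s2I) -(@eval_key q (var nJ) s2 j).
  apply: does_if => [|/eqP]; rewrite test => jk.
    by apply: does_skip; rewrite big_ord_recr /= (negPf jk) addr0.
  apply: does_put; rewrite updD /= h big_ord_recr /= sj ag ?touchedD //= /s1 updD /=.
  by rewrite jk.
move=> t [s' [r le [ag h]]]; exists t, s'; split=> //; split.
  apply: agree_trans ag; apply: agree_upd; by [].
by rewrite h /line [RHS]big_mkcond; apply: eq_bigr => b _; rewrite ffunE.
Qed.

Lemma does_direction_test N s j q (a : nat) : cell s nN = N%:Z -> cell s nI = a%:Z ->
  (j.+2 < o)%N ->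
  does (direction_test j q) s (N * 4 + 4)
    (fun s' => agree (touched [:: nJ; nSum; nAcc]) s s' /\
       cell s' nAcc = cell s nAcc
         + cell s nPen * `|line q (vec_at N s nX) a - s j.+2 (key q a)%:Z|).
Proof.
move=> sN sa jo; rewrite (_ : (N * 4 + 4 = (N * 4 + 3) + 1)%N); last lia.
apply: does_bind (does_line_loop _ sN sa) _ => s1 [ag s1S].
apply: does_put; split.
  apply: agree_trans (agree_sub (touched_sub _) ag) _; last exact: agree_upd.
  by move=> i; rewrite !inE orbA => ->.
set ab := abs_expr _.
have abE : eval s1 ab = `|line q (vec_at N s nX) a - s j.+2 (key q a)%:Z|.
  rewrite eval_abs (_ : eval s1 _ = cell s1 nSum - s1 j.+2 (eval s1 (key_expr q (var nI)))) //.
  by rewrite s1S (@eval_key q (var nI) s1 a) /= ag ?touchedD ?touched_lt.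
by move: ab abE => ab abE; rewrite updD !eqxx /= abE !ag ?touchedD.
Qed.

Lemma does_direction_tests N s j0 qs' (a : nat) : cell s nN = N%:Z -> cell s nI = a%:Z ->
  (j0 + size qs' + 2 <= o)%N ->
  does (direction_tests j0 qs') s (size qs' * (N * 4 + 4) + 1)
    (fun s' => agree (touched [:: nJ; nSum; nAcc]) s s' /\
       cell s' nAcc = cell s nAcc + \sum_(j < size qs')
         cell s nPen * `|line (dir qs' j) (vec_at N s nX) a
                         - s (j0 + j).+2 (key (dir qs' j) a)%:Z|).
Proof.
elim: qs' j0 s => [|q qs' IH] j0 s sN sa le.
  by apply: does_skip; split=> //; rewrite big_ord0 addr0.
rewrite mulSn -addnA; move: le; rewrite [size (_ :: _)]/= => le.
apply: does_bind (does_direction_test q sN sa _) _ => [|s1 [ag s1A]]; first lia.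
have [|||t [s' [r h [ag' s'A]]]] := IH j0.+1 s1; try by rewrite ag ?touchedD.
  lia.
exists t, s'; split=> //; split; first exact: agree_trans ag ag'.
have xE : vec_at N s1 nX = vec_at N s nX.
  by apply/ffunP => b; rewrite !ffunE ag ?touchedD.
rewrite s'A s1A xE big_ord_recl [nat_of_ord ord0]/= addn0 -addrA; congr (_ + (_ + _)).
apply: eq_bigr => j _; rewrite lift0 -(addSnnS j0) !ag ?touchedD ?touched_lt //.
by have := ltn_ord j; lia.
Qed.

Lemma writes_direction_tests j0 qs' :
  writes (touched [:: nJ; nSum; nAcc]) (direction_tests j0 qs').
Proof. by elim: qs' j0 => //= q qs' IH j0; rewrite !touchedD /= IH. Qed.

Section Search.
Variables (e : store) (N : nat).
Hypothesis eN : cell e nN = N%:Z.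

Definition same_data (s : store) : Prop := forall k a, (k < o + 4)%N -> s k a = e k a.

Definition value (x : vec N) : int :=
  obj qs (fun a => e 1%N a%:Z) (fun j a => e j.+2 a%:Z) (cell e nPen) x.

Lemma same_data_agree I s s' : all (leq 4) I -> agree (touched I) s s' ->
  same_data s -> same_data s'.
Proof.
clear o_large eN; move=> /allP I4 ag sd k a ko; rewrite -sd //; apply: ag.
by apply/negP => /andP[ok /I4]; lia.
Qed.

Lemma vec_at_agree S i s s' : agree (touched S) s s' -> i \notin S ->
  vec_at N s' i = vec_at N s i.
Proof. by move=> ag iS; apply/ffunP => a; rewrite !ffunE ag // touchedD. Qed.

Definition objective_time : nat := N * (size qs * (N * 4 + 4) + 4) + 3.

Lemma does_objective s : same_data s ->
  does objective s objective_time
    (fun s' => agree (touched [:: nI; nJ; nSum; nAcc]) s s' /\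
               cell s' nAcc = value (vec_at N s nX)).
Proof.
move=> sd; rewrite (_ : objective_time = 1 + (objective_time - 1))%N; last first.
  by rewrite /objective_time; lia.
apply/does_seq/does_put => /=; set s1 := upd _ _ _ _.
have sd1 : same_data s1.
  by apply: same_data_agree sd; last exact: (@agree_upd o [:: nAcc]).
have x1 : vec_at N s1 nX = vec_at N s nX.
  by apply/ffunP => b; rewrite !ffunE /s1 updD.
set x := vec_at N s nX in x1 *.
pose term (a : nat) := (e 1%N a%:Z * s (o + nX)%N a%:Z
  + cell e nPen * (`|s (o + nX)%N a%:Z| - s (o + nX)%N a%:Z))
  + \sum_(j < size qs) cell e nPen * `|line (dir qs j) x a - e j.+2 (key (dir qs j) a)%:Z|.
have := @does_for o [:: nJ; nSum; nAcc] nI objective_body s1 N (size qs * (N * 4 + 4) + 2)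
  (fun j s' => cell s' nAcc = \sum_(b < j) term b).
case=> //.
- by rewrite /= touchedD /= writes_direction_tests.
- by rewrite sd1 // ltn_add2l.
- by move=> j s2 z h; rewrite updD.
- by rewrite /s1 updD /= big_ord0.
- move=> j s2 jN ag sj h.
  have sd2 : same_data s2 by apply: same_data_agree sd1; last exact: ag.
  have x2 : vec_at N s2 nX = x by rewrite (vec_at_agree ag).
  rewrite (_ : (size qs * (N * 4 + 4) + 2 = 1 + (size qs * (N * 4 + 4) + 1))%N); last lia.
  apply/does_seq/does_put; set s3 := upd _ _ _ _.
  have ag3 : agree (touched [:: nAcc]) s2 s3 by apply: agree_upd.
  have sd3 : same_data s3 by apply: same_data_agree sd2; last exact: ag3.
  have s3I : cell s3 nI = j by rewrite ag3 ?touchedD.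
  have s3N : cell s3 nN = N by rewrite sd3 // ltn_add2l.
  have s3A : cell s3 nAcc = \sum_(b < j) term b + (e 1%N j%:Z * s (o + nX)%N j%:Z
      + cell e nPen * (`|s (o + nX)%N j%:Z| - s (o + nX)%N j%:Z)).
    have absE (z : int) : (1 - 2 * (if z <= 0 then 1 else 0)) * z = `|z|.
      by case: (lerP z 0); lia.
    have xj : s2 (o + nX)%N j%:Z = s (o + nX)%N j%:Z by rewrite ag ?touchedD // /s1 updD.
    by rewrite /s3 updD /= sj h xj absE !sd2 ?ltn_add2l //; lia.
  apply: does_le (does_direction_tests (j0 := 0) s3N s3I _) _ _ => // s' [_ ->].
  rewrite (vec_at_agree ag3) // x2 big_ord_recr s3A /= /term -addrA; congr (_ + (_ + _)).
  apply: eq_bigr => i _.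
  by rewrite add0n !sd3 ?ltn_add2l //; have := ltn_ord i; lia.
move=> t [s' [r le [ag h]]]; exists t, s'; split=> //; first by rewrite /objective_time in le *; nia.
split; first by apply: agree_trans ag; exact: (@agree_upd o [:: nI; nJ; nSum; nAcc]).
rewrite h /value /obj /cost /defect mulr_sumr -big_split; apply: eq_bigr => a _ /=.
by rewrite /term !ffunE [X in _ = _ + X]mulrDr addrA mulr_sumr.
Qed.



(** The record held in [nBest], [nBestX] and [nFlag] never gets worse, and the flag
    tells whether it has been beaten. *)
Definition recorded (s : store) : Prop := cell s nBest = value (vec_at N s nBestX).

Definition progress (s s' : store) : Prop :=
  recorded s' /\ ((cell s' nFlag = cell s nFlag /\ cell s' nBest = cell s nBest)
                  \/ (cell s' nFlag = 1 /\ cell s' nBest < cell s nBest)).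

Lemma progress_refl s : recorded s -> progress s s.
Proof. by split=> //; left. Qed.

Lemma progress_le s s' : progress s s' -> cell s' nBest <= cell s nBest.
Proof. by case=> _ [[_ ->]|[_ /ltW]]. Qed.

Lemma progress_trans s1 s2 s3 : progress s1 s2 -> progress s2 s3 -> progress s1 s3.
Proof.
move=> [_ p12] [r3 p23]; split=> //.
case: p12 p23 => -[f12 b12] [[f23 b23]|[f23 b23]].
- by left; rewrite f23 b23.
- by right; rewrite -b12.
- by right; rewrite f23 b23.
by right; split=> //; apply: lt_trans b23 b12.
Qed.

Lemma progress_agree I s0 s s' : agree (touched I) s s' ->
  nBest \notin I -> nBestX \notin I -> nFlag \notin I -> progress s0 s -> progress s0 s'.
Proof.
move=> ag b x f; rewrite /progress /recorded (vec_at_agree ag) //.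
by rewrite !ag ?touchedD.
Qed.

Lemma recorded_agree I s s' : agree (touched I) s s' ->
  nBest \notin I -> nBestX \notin I -> recorded s -> recorded s'.
Proof.
by move=> ag b x; rewrite /recorded (vec_at_agree ag) // ag ?touchedD.
Qed.

Definition compare_time : nat := objective_time + (N * 3 + 5).

Lemma does_compare s : same_data s -> recorded s ->
  does compare s compare_time
    (fun s' => [/\ agree (touched [:: nBestX; nAcc; nSum; nI; nJ; nBest; nFlag]) s s',
       progress s s' & cell s' nBest <= value (vec_at N s nX)]).
Proof.
move=> sd rec; apply: does_bind (does_objective sd) _ => s1 [ag1 acc1].
have sd1 : same_data s1 by apply: same_data_agree sd; last exact: ag1.
have rec1 : recorded s1 by apply: recorded_agree rec; first exact: ag1.
have ag1' : agree (touched [:: nBestX; nAcc; nSum; nI; nJ; nBest; nFlag]) s s1.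
  by apply: agree_sub ag1; apply: touched_sub => i; rewrite !inE => /or4P[] /eqP->.
have b1 : cell s1 nBest = cell s nBest by rewrite ag1 ?touchedD.
have f1 : cell s1 nFlag = cell s nFlag by rewrite ag1 ?touchedD.
rewrite (_ : (N * 3 + 5 = (N * 3 + 4).+1)%N); last lia.
apply: does_if => /=; rewrite acc1 b1; case: ifP => // cmp _; last first.
  exists 1%N, s1; split=> //; [exact: runs_skip | lia | split=> //; last lia].
  by split=> //; left.
rewrite (_ : (N * 3 + 4 = 1 + (1 + (N * 3 + 2)))%N); last lia.
apply/does_seq/does_put => /=; set s2 := upd s1 _ _ _.
apply/does_seq/does_put => /=; set s3 := upd s2 _ _ _.
have ag3 : agree (touched [:: nBest; nFlag]) s1 s3.
  apply: (agree_trans (s2 := s2)); first exact: agree_upd.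
  by apply: agree_upd.
have x3 : vec_at N s3 nX = vec_at N s nX by rewrite (vec_at_agree ag3) // (vec_at_agree ag1).
have s3N : cell s3 nN = N by rewrite ag3 ?touchedD // sd1 ?ltn_add2l.
apply: does_le (does_copy s3N _ _ _ _) _ _ => // s' [ag' x'].
have b' : cell s' nBest = value (vec_at N s nX).
  by rewrite ag' ?touchedD // /s3 updD /= /s2 updD /= acc1.
split; last by rewrite b'.
  apply: agree_trans ag1' _.
  apply: (agree_trans (s2 := s3)); [apply: agree_sub ag3 | apply: agree_sub ag'];
    by apply: touched_sub => i; rewrite !inE => /orP[] /eqP->.
split; first by rewrite /recorded x' x3.
by right; rewrite b' ag' ?touchedD // /s3 updD /=; split=> //; lia.
Qed.

(** The arrays from [nX] to [nFlag] and the counters of the first [k] nested loops. *)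
Definition explore_touched (k : nat) : seq nat := iota 4 8 ++ iota 13 k.

Arguments explore_touched : simpl never.

Lemma explore_touchedE k i : (i \in explore_touched k) = ((3 < i < 12) || (12 < i < 13 + k))%N.
Proof. by rewrite mem_cat !mem_iota. Qed.

Lemma writes_explore k : writes (touched (explore_touched k)) (explore k).
Proof.
elim: k => [|k IH] /=.
  have sub : {subset touched [:: nJ; nSum; nAcc] <= touched (explore_touched 0)}.
    by apply: touched_sub => i; rewrite explore_touchedE !inE => /or3P[] /eqP->.
  by rewrite !touchedD !(writes_sub sub (writes_direction_tests _ _)).
have sub : {subset touched (explore_touched k) <= touched (explore_touched k.+1)}.
  by apply: touched_sub => i; rewrite !explore_touchedE; lia.
rewrite !touchedD !explore_touchedE !(writes_sub sub IH) /=; lia.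
Qed.

Fixpoint explore_time (k : nat) : nat :=
  if k is k'.+1 then explore_time k' + (N * (2 * explore_time k' + 5) + 2) else compare_time.

Lemma displacement_cons (m : move N) ms :
  displacement (m :: ms) = unit_vec m + displacement ms.
Proof. by rewrite /displacement big_cons. Qed.

Lemma does_shift s k z l (p : 'I_N) : cell s nStep = l -> cell s (nMove k) = (p : nat)%:Z ->
  does (shift k z) s 1
    (fun s' => agree (touched [:: nX]) s s' /\
       vec_at N s' nX = [ffun a => vec_at N s nX a + (if a == p then z * l else 0)]).
Proof.
move=> sl sp; apply: does_put; split; first exact: agree_upd.
apply/ffunP => a; rewrite !ffunE /= updD sp sl eqxx /= eqz_nat.
by rewrite (inj_eq val_inj); case: eqP => [->|]; rewrite ?addr0.
Qed.

(** Each loop moves one entry up, explores, moves it down past its initial value, explores, and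
    moves it back, so that the vector [nX] is restored. *)
Lemma does_explore (l : nat) k s : same_data s -> recorded s -> cell s nStep = l%:Z ->
  does (explore k) s (explore_time k)
    (fun s' => [/\ agree (touched (explore_touched k)) s s', progress s s',
       vec_at N s' nX = vec_at N s nX
     & forall ms : seq (move N), size ms = k ->
         cell s' nBest <= value (vec_at N s nX + displacement ms *+ l)]).
Proof.
elim: k s => [|k IH] s sd rec sl.
  apply: does_le (does_compare sd rec) _ _ => // s' [ag pr le]; split=> //.
  - apply: agree_sub ag; apply: touched_sub => i; rewrite explore_touchedE !inE; lia.
  - by rewrite (vec_at_agree ag).
  by move=> ms /size0nil->; rewrite /displacement big_nil mul0rn addr0.
have sub : {subset touched (explore_touched k) <= touched (explore_touched k.+1)}.
  by apply: touched_sub => i; rewrite !explore_touchedE; lia.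
have data_ok I s1 s2 : {subset I <= explore_touched k.+1} -> agree (touched I) s1 s2 ->
    same_data s1 -> same_data s2.
  move=> Ik ag; apply: same_data_agree ag; apply/allP => i /Ik; rewrite explore_touchedE; lia.
apply: does_bind (IH s sd rec sl) _ => s1 [ag1 pr1 x1 le1].
have sd1 : same_data s1.
  by apply: data_ok ag1 sd => i; rewrite !explore_touchedE; lia.
set x := vec_at N s nX in le1 x1 *.
pose seen (m : move N) s' := forall ms : seq (move N), size ms = k ->
  cell s' nBest <= value (x + displacement (m :: ms) *+ l).
have seen_le m sa sb : cell sb nBest <= cell sa nBest -> seen m sa -> seen m sb.
  by move=> le sn ms /sn; apply: le_trans.
have seen_shift m sa sb : vec_at N sa nX = x + unit_vec m *+ l ->
    (forall ms : seq (move N), size ms = k ->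
       cell sb nBest <= value (vec_at N sa nX + displacement ms *+ l)) -> seen m sb.
  by move=> xa h ms /h; rewrite xa displacement_cons mulrnDl addrA.
have := @does_for o (explore_touched k) (nMove k) (Seq (shift k 1) (Seq (explore k)
    (Seq (shift k (-2)) (Seq (explore k) (shift k 1))))) s1 N (2 * explore_time k + 3)
  (fun j s' => [/\ vec_at N s' nX = x, progress s s', seen None s' &
     forall (p : 'I_N) b, (p < j)%N -> seen (Some (p, b)) s']).
case.
- by rewrite /= !touchedD explore_touchedE !writes_explore.
- by rewrite !explore_touchedE; lia.
- by [].
- by rewrite sd1 ?ltn_add2l.
- move=> j s2 z [xs pr sn h].
  have ag : agree (touched [:: nMove k]) s2 (upd s2 (o + nMove k) 0 z).
    by apply: agree_upd; rewrite mem_head.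
  have b2 : cell (upd s2 (o + nMove k) 0 z) nBest = cell s2 nBest.
    by rewrite ag // touchedD.
  split; first by rewrite (vec_at_agree ag).
  + by apply: progress_agree pr; first exact: ag.
  + by apply: seen_le sn; rewrite b2.
  by move=> p b /(h p b); apply: seen_le; rewrite b2.
- split=> // ms msk; rewrite displacement_cons add0r; exact: le1.
- move=> j s2 jN ag2 sj [x2 pr2 sn2 h2]; pose p := Ordinal jN.
  have sd2 : same_data s2.
    by apply: data_ok ag2 sd1 => i; rewrite inE !explore_touchedE; lia.
  have sl2 : cell s2 nStep = l.
    rewrite ag2 ?touchedD; last by rewrite inE explore_touchedE.
    by rewrite ag1 // touchedD explore_touchedE.
  rewrite (_ : (2 * explore_time k + 3 =
    1 + (explore_time k + (1 + (explore_time k + 1))))%N); last lia.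
  apply: does_bind (does_shift 1 (p := p) sl2 sj) _ => s3 [ag3 x3].
  have k3 : {subset [:: nX] <= explore_touched k.+1}.
    by move=> i; rewrite inE explore_touchedE => /eqP->.
  have sl3 : cell s3 nStep = l by rewrite ag3 ?touchedD.
  have pr3 : progress s s3 by apply: progress_agree pr2; first exact: ag3.
  have rec3 : recorded s3 by case: pr3.
  apply: does_bind (IH s3 (data_ok _ _ _ k3 ag3 sd2) rec3 sl3) _ => s4 [ag4 pr4 x4 le4].
  have sl4 : cell s4 nStep = l by rewrite ag4 ?touchedD ?explore_touchedE.
  have sj4 : cell s4 (nMove k) = (p : nat).
    rewrite ag4 ?touchedD ?explore_touchedE; last by lia.
    by rewrite ag3 ?touchedD.
  have sd4 : same_data s4.
    apply: data_ok ag4 (data_ok _ _ _ k3 ag3 sd2) => i; rewrite !explore_touchedE; lia.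
  apply: does_bind (does_shift (-2) (p := p) sl4 sj4) _ => s5 [ag5 x5].
  have sl5 : cell s5 nStep = l by rewrite ag5 ?touchedD.
  have pr5 : progress s s5.
    by apply: progress_agree (progress_trans pr3 pr4); first exact: ag5.
  have rec5 : recorded s5 by case: pr5.
  apply: does_bind (IH s5 (data_ok _ _ _ k3 ag5 sd4) rec5 sl5) _ => s6 [ag6 pr6 x6 le6].
  have sl6 : cell s6 nStep = l by rewrite ag6 ?touchedD ?explore_touchedE.
  have sj6 : cell s6 (nMove k) = (p : nat).
    rewrite ag6 ?touchedD ?explore_touchedE; last by lia.
    by rewrite ag5 ?touchedD.
  apply: does_le (does_shift 1 (p := p) sl6 sj6) _ _ => // s7 [ag7 x7].
  have pr7 : progress s s7.
    by apply: progress_agree (progress_trans pr5 pr6); first exact: ag7.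
  have b3 : cell s3 nBest = cell s2 nBest by rewrite ag3 ?touchedD.
  have b5 : cell s5 nBest = cell s4 nBest by rewrite ag5 ?touchedD.
  have b7 : cell s7 nBest = cell s6 nBest by rewrite ag7 ?touchedD.
  have le74 : cell s7 nBest <= cell s4 nBest by rewrite b7 -b5 progress_le.
  have le72 : cell s7 nBest <= cell s2 nBest by rewrite -b3 (le_trans le74) ?progress_le.
  have x3' : vec_at N s3 nX = x + unit_vec (Some (p, true)) *+ l.
    rewrite x3 x2; apply/ffunP => a; rewrite !ffunE ffunMnE ffunE.
    by case: eqP => _; rewrite ?mul0rn // mul1r natz.
  have x5' : vec_at N s5 nX = x + unit_vec (Some (p, false)) *+ l.
    rewrite x5 x4 x3'; apply/ffunP => a; rewrite !ffunE !ffunMnE !ffunE.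
    by case: eqP => _; rewrite ?mul0rn ?addr0 // mulNrn !natz; lia.
  split=> //.
  + rewrite x7 x6 x5'; apply/ffunP => a; rewrite !ffunE !ffunMnE !ffunE.
    by case: eqP => _; rewrite ?mul0rn ?addr0 // mulNrn !natz; lia.
  + exact: seen_le sn2.
  move=> p' b; rewrite ltnS leq_eqVlt => /orP[/eqP pj|pj]; last exact: seen_le (h2 p' b pj).
  have {pj} -> : p' = p by apply: val_inj.
  case: b; first by apply: seen_le le74 (seen_shift _ _ _ x3' le4).
  by apply: seen_le (seen_shift _ _ _ x5' le6); rewrite b7.
move=> t [s' [r le [ag [xs pr sn h]]]]; exists t, s'; split=> //.
  by apply: leq_trans le _; rewrite -[X in (_ <= N * (2 * X + 5) + 2)%N]/(explore_time k); lia.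
split=> //; last first.
  case=> // -[[p b]|] ms [msk]; [exact: (h p b (ltn_ord p)) | exact: sn].
apply: agree_trans (agree_sub sub ag1) _; apply: agree_sub ag.
by apply: touched_sub => i; rewrite inE !explore_touchedE; lia.
Qed.

End Search.
End Program.

(** * Convergence of the search *)

Lemma double_pred_exp R : (0 < R)%N -> (2 * R.-1 ^ R <= R ^ R)%N.
Proof.
case: R => // r _ /=; have bernoulli k : (r ^ k * (r + k) <= r.+1 ^ k * r)%N.
  elim: k => [|k IH]; first by rewrite !expn0 addn0.
  rewrite !expnS; move: IH; move: (r ^ k)%N (r.+1 ^ k)%N => x y; nia.
case: (posnP r) => [->|r0]; first by rewrite exp0n.
have := bernoulli r.+1; move: (r ^ r.+1)%N (r.+1 ^ r.+1)%N => x y; nia.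
Qed.

(** A gap that shrinks by the factor [1 - 1 / R] in each round is halved after [R] rounds. *)
Lemma gap_vanishes R L g0 g : (0 < R)%N -> (g0 < 2 ^ L)%N ->
  (R ^ (R * L) * g <= R.-1 ^ (R * L) * g0)%N -> g = 0%N.
Proof.
move=> R0 g0L le; have dp := double_pred_exp R0; case: (posnP g) => // g_gt0.
have dpL : (2 ^ L * R.-1 ^ (R * L) <= R ^ (R * L))%N.
  by rewrite !expnM -expnMn; case: (L) => // l; rewrite leq_exp2r.
have RR : (0 < R ^ (R * L))%N by rewrite expn_gt0 R0.
have : (R ^ (R * L) <= R.-1 ^ (R * L) * g0)%N by apply: leq_trans le; rewrite leq_pmulr.
move: dpL RR g0L; move: (R.-1 ^ _)%N (R ^ _)%N (2 ^ L)%N => x y z; nia.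
Qed.

Section SearchLoop.
Variables (o : nat) (qs : seq (nat * nat)).
Hypothesis o_large : (size qs + 2 <= o)%N.
Variables (e : store) (N K : nat).
Hypothesis eN : e (o + nN)%N 0 = N%:Z.

Local Notation var := (var o).
Local Notation set := (set o).
Local Notation touched := (touched o).
Local Notation cell s i := ((s : store) (o + i)%N 0).
Local Notation same_data := (same_data o e).
Local Notation value := (@value o qs e N).
Local Notation recorded := (recorded o qs e N).
Local Notation progress := (progress o qs e N).
Local Notation vec_at := (vec_at o N).

Definition scan : prog :=
  While (Bin Leq (var nStep) (var nMax))
    (Seq (explore o qs K) (set nStep (Bin Add (var nStep) (var nStep)))).

Definition round : prog :=
  Seq (set nFlag (Cst 0)) (Seq (set nStep (Cst 1)) (Seq scan (copy_loop o nBestX nX))).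

Definition search : prog := While (var nFlag) round.

Variable T : nat.
Hypothesis T_large : (`|cell e nMax| < 2 ^ T)%N.

Definition scan_time : nat := (T * (explore_time qs N K).+2).+1.

Lemma does_scan s : same_data s -> recorded s -> cell s nStep = 1 ->
  does scan s scan_time
    (fun s' => [/\ agree (touched (nStep :: explore_touched K)) s s', progress s s',
       vec_at s' nX = vec_at s nX
     & forall t (ms : seq (move N)), size ms = K -> (2 ^ t)%N%:Z <= cell e nMax ->
         cell s' nBest <= value (vec_at s nX + displacement ms *+ 2 ^ t)]).
Proof.
move=> sd rec s1; set x := vec_at s nX.
pose J k s' := exists t, [/\ (t + k = T)%N, cell s' nStep = (2 ^ t)%N%:Z,
  agree (touched (nStep :: explore_touched K)) s s', progress s s' & vec_at s' nX = x /\
  forall t' (ms : seq (move N)), size ms = K -> (t' < t)%N ->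
         cell s' nBest <= value (x + displacement ms *+ 2 ^ t')].
have sd_ag s' : agree (touched (nStep :: explore_touched K)) s s' -> same_data s'.
  move=> ag; apply: same_data_agree sd; last exact: ag.
  by apply/allP => i; rewrite inE explore_touchedE; lia.
have sL s' : agree (touched (nStep :: explore_touched K)) s s' -> cell s' nMax = cell e nMax.
  by move/sd_ag => -> //; rewrite ltn_add2l.
have step k s' : J k s' -> eval s' (Bin Leq (var nStep) (var nMax)) != 0 ->
    exists2 k', k = k'.+1 & does (Seq (explore o qs K)
      (set nStep (Bin Add (var nStep) (var nStep)))) s' (explore_time qs N K).+1 (J k').
  move=> [t [tk st ag pr [xx seen]]] /=; rewrite st sL //; case: ifP => // tL _.
  have tT : (t < T)%N by rewrite -(ltn_exp2l t T (ltnSn 1)); lia.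
  case: k tk => [|k] tk; first lia.
  exists k => //; rewrite -[X in does _ _ X]addn1.
  have rec' : recorded s' by case: pr.
  apply: does_bind (does_explore o_large eN K (sd_ag _ ag) rec' st) _ => s2 [ag2 pr2 x2 le2].
  have st2 : cell s2 nStep = (2 ^ t)%N%:Z by rewrite ag2 // touchedD explore_touchedE.
  apply: does_put; rewrite [eval _ _]/= [eval _ (Bin _ _ _)]/= st2; set s3 := upd _ _ _ _.
  have ag3 : agree (touched [:: nStep]) s2 s3 by apply: agree_upd; rewrite mem_head.
  have b3 : cell s3 nBest = cell s2 nBest by rewrite ag3 ?touchedD.
  exists t.+1; split; first lia.
  - by rewrite /s3 updD !eqxx expnS /=; lia.
  - apply: agree_trans ag _; apply: (agree_trans (s2 := s2)); [apply: agree_sub ag2|apply: agree_sub ag3];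
      by apply: touched_sub => i; rewrite !inE => ->; rewrite ?orbT.
  - by apply: progress_agree (progress_trans pr pr2); first exact: ag3.
  split; first by rewrite (vec_at_agree _ ag3) // x2.
  move=> t' ms msK; rewrite ltnS leq_eqVlt b3 => /orP[/eqP->|tt].
    by rewrite -xx; apply: le2.
  by apply: le_trans (progress_le pr2) (seen _ _ msK tt).
have J0 : J T s by exists 0%N; split=> //; exact: progress_refl.
apply: does_le (does_while step J0) (leqnn _) _ => s' [e0 [k [t [tk st ag pr [xx seen]]]]].
split=> // t' ms msK tL; apply: seen => //.
move: e0; rewrite /= st sL //; case: ifP => // + _ => tL'.
rewrite ltnNge; apply/negP => tt; move/negP: tL'; apply; apply: le_trans tL.
by rewrite lez_nat leq_exp2l.
Qed.

Definition round_time : nat := scan_time + (N * 3 + 4).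

Lemma does_round s : same_data s -> recorded s -> vec_at s nX = vec_at s nBestX ->
  does round s round_time
    (fun s' => [/\ same_data s', recorded s', vec_at s' nX = vec_at s' nBestX,
       (cell s' nFlag = 0 /\ cell s' nBest = cell s nBest)
         \/ (cell s' nFlag = 1 /\ cell s' nBest < cell s nBest)
     & forall t (ms : seq (move N)), size ms = K -> (2 ^ t)%N%:Z <= cell e nMax ->
         cell s' nBest <= value (vec_at s nX + displacement ms *+ 2 ^ t)]).
Proof.
move=> sd rec xx.
rewrite (_ : round_time = 1 + (1 + (scan_time + (N * 3 + 2))))%N; last first.
  by rewrite /round_time; lia.
apply/does_seq/does_put => /=; set s1 := upd s _ _ _.
apply/does_seq/does_put => /=; set s2 := upd s1 _ _ _.
have ag2 : agree (touched [:: nFlag; nStep]) s s2.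
  by apply: (agree_trans (s2 := s1)); apply: agree_upd.
have sd2 : same_data s2 by apply: same_data_agree sd; last exact: ag2.
have rec2 : recorded s2 by apply: recorded_agree rec; first exact: ag2.
have x2 : vec_at s2 nX = vec_at s nX by rewrite (vec_at_agree _ ag2).
have b2 : cell s2 nBest = cell s nBest by rewrite ag2 ?touchedD.
have f2 : cell s2 nFlag = 0 by rewrite /s2 updD /= /s1 updD.
apply: does_bind (does_scan sd2 rec2 _) _ => [|s3 [ag3 pr3 x3 le3]].
  by rewrite /s2 updD.
have sd3 : same_data s3.
  apply: same_data_agree sd2; last exact: ag3.
  by apply/allP => i; rewrite inE explore_touchedE; lia.
have s3N : cell s3 nN = N by rewrite sd3 ?ltn_add2l.
apply: does_le (does_copy s3N _ _ _ _) _ _ => // s4 [ag4 x4].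
have b4 : cell s4 nBest = cell s3 nBest by rewrite ag4 ?touchedD.
have f4 : cell s4 nFlag = cell s3 nFlag by rewrite ag4 ?touchedD.
have [rec3 pr] := pr3; split.
- by apply: same_data_agree sd3; last exact: ag4.
- by apply: recorded_agree rec3; first exact: ag4.
- by rewrite x4 (vec_at_agree _ ag4).
- by rewrite b4 f4 -b2; case: pr => -[p1 p2]; [left; rewrite p1 p2 f2 | right; rewrite p1].
by move=> t ms msK tL; rewrite b4 -x2; apply: le3.
Qed.

Variables (R L : nat) (opt : int).
Hypothesis R_gt0 : (0 < R)%N.
Hypothesis opt_le : forall x, opt <= value x.
Hypothesis start_gap : (`|value 0%R - opt| < 2 ^ L)%N.
Hypothesis good_step : forall x, value x <= value 0 -> opt < value x ->
  exists t, exists2 ms : seq (move N), size ms = K & (2 ^ t)%N%:Z <= cell e nMax /\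
    value x - opt <= R%:Z * (value x - value (x + displacement ms *+ 2 ^ t)).

Definition search_time : nat := ((R * L).+1 * round_time.+1).+1.

(** A round that raises the flag has beaten the record, so the gap to the optimum was positive and
    has shrunk by the factor [1 - 1 / R]; a round that leaves the flag down has found no
    improvement, which by [good_step] happens only at an optimum. After [R * L] rounds of the
    first kind the gap is zero, so one more round ends the search. *)
Lemma does_search s : same_data s -> recorded s -> vec_at s nX = 0 -> vec_at s nBestX = 0 ->
  cell s nFlag = 1 ->
  does search s search_time
    (fun s' => [/\ same_data s', recorded s', vec_at s' nX = vec_at s' nBestX
                 & cell s' nBest = opt]).
Proof.
move=> sd rec x0 b0 f1.
pose gap (s : store) := `|cell s nBest - opt|%N.
pose J k s := [/\ same_data s, recorded s, vec_at s nX = vec_at s nBestX,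
  value (vec_at s nX) <= value 0 & (cell s nFlag = 0 /\ cell s nBest = opt) \/
  (cell s nFlag = 1 /\ exists i, [/\ (i + k = (R * L).+1)%N, (0 < k)%N &
     (R ^ i * gap s <= R.-1 ^ i * `|(value 0 - opt)%R|)%N])].
have step k s1 : J k s1 -> eval s1 (var nFlag) != 0 ->
    exists2 k', k = k'.+1 & does round s1 round_time (J k').
  move=> [sd1 rec1 xx le0 [[f _]|[f [i [ik k0 ig]]]]]; first by rewrite /= f.
  case: k ik k0 => // k ik _ _; exists k => //.
  apply: does_le (does_round sd1 rec1 xx) _ _ => // s2 [sd2 rec2 xx2 fl le2].
  have v1 : cell s1 nBest = value (vec_at s1 nX) by rewrite xx.
  have v2 : cell s2 nBest = value (vec_at s2 nX) by rewrite xx2.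
  have o1 := opt_le (vec_at s1 nX); have o2 := opt_le (vec_at s2 nX).
  have gain : opt < cell s1 nBest ->
      cell s1 nBest - opt <= R%:Z * (cell s1 nBest - cell s2 nBest).
    rewrite v1 => /(good_step le0)[t [ms msK [tL le]]]; apply: le_trans le _.
    by rewrite ler_wpM2l // lerD2l lerN2 le2.
  split=> //; first by rewrite -v2; case: fl => -[_]; lia.
  case: fl => -[f2 fb]; [left|right]; split=> //.
    by apply/eqP; rewrite eq_le v2 o2 andbT -v2 leNgt fb; apply/negP => lt1; have := gain lt1; rewrite fb subrr mulr0; lia.
  have gt1 : opt < cell s1 nBest by lia.
  exists i.+1; split; first lia.
    case: (posnP k) => // k0; have ig' : i = (R * L)%N by lia.
    have := gap_vanishes R_gt0 start_gap; rewrite -ig' => /(_ _ ig); rewrite /gap; lia.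
  have g2 : (R * gap s2 <= R.-1 * gap s1)%N.
    have := gain gt1; rewrite /gap; case: (R) R_gt0 => // r _ /=.
    by move: (cell s1 nBest) (cell s2 nBest) fb gt1 v2 o2 => c1 c2; nia.
  rewrite !expnS -!mulnA; apply: (leq_trans (n := R ^ i * (R.-1 * gap s1))).
    by rewrite mulnCA leq_mul2l g2 orbT.
  by rewrite mulnCA leq_mul2l ig orbT.
have J0 : J (R * L).+1 s.
  split=> //; [by rewrite x0 b0 | by rewrite x0 | right; split=> //].
  by exists 0%N; split=> //; rewrite !expn0 !mul1n /gap rec b0.
apply: does_le (does_while step J0) (leqnn _) _ => s' [/= f0 [k [sd' rec' xx _ [[_ //]|[f _]]]]].
by rewrite f in f0.
Qed.

End SearchLoop.

(** * Positions of multi-indices *)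

Definition radix D (b : 'I_D -> nat) (t : nat) : nat := (\prod_(k < D | k < t) b k)%N.

Section Positions.
Variables (D : nat) (b : 'I_D -> nat).

Lemma radix0 : radix b 0 = 1%N.
Proof. by rewrite /radix big_pred0. Qed.

Lemma radixS (t : 'I_D) : radix b t.+1 = (radix b t * b t)%N.
Proof.
rewrite /radix (bigD1 t) //= mulnC; congr (_ * _)%N; apply: eq_bigl => k.
by rewrite ltnS ltn_neqAle andbC.
Qed.

Lemma radix_all : radix b D = (\prod_k b k)%N.
Proof. by apply: eq_bigl => k; rewrite ltn_ord. Qed.

Definition low (i : mindex b) (t : nat) : nat := (\sum_(j < D | j < t) i j * radix b j)%N.

Lemma lowS i (t : 'I_D) : low i t.+1 = (low i t + i t * radix b t)%N.
Proof.
rewrite /low (bigD1 t) //= addnC; congr (_ + _)%N; apply: eq_bigl => k.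
by rewrite ltnS ltn_neqAle andbC.
Qed.

Lemma flat_posE (i : mindex b) : flat_pos i = low i D.
Proof. by rewrite /flat_pos /low; apply: eq_big => // k; rewrite ltn_ord. Qed.

Lemma low_lt i t : (t <= D)%N -> (low i t < radix b t)%N.
Proof.
elim: t => [|t IH] tD; first by rewrite radix0 /low big_pred0.
rewrite -[t]/(nat_of_ord (Ordinal tD)) lowS radixS /=.
have := IH (ltnW tD); have := ltn_ord (i (Ordinal tD)).
move: (low i t) (radix b t) (nat_of_ord (i _)) => l r x.
by move: (b _) => c; nia.
Qed.

Lemma flat_pos_lt (i : mindex b) : (flat_pos i < \prod_k b k)%N.
Proof. by rewrite flat_posE -radix_all low_lt. Qed.

Lemma flat_pos_inj : injective (@flat_pos D b).
Proof.
move=> i i'; rewrite !flat_posE => e.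
have lowE k : (k <= D)%N -> low i (D - k) = low i' (D - k).
  elim: k => [|k IH] kD; first by rewrite subn0.
  have tD : (D - k.+1 < D)%N by rewrite ltn_subrL (leq_ltn_trans _ kD).
  have := IH (ltnW kD); rewrite -(subnSK kD).
  rewrite -[(D - k.+1)%N]/(nat_of_ord (Ordinal tD)) !lowS.
  move: (low_lt i (ltnW tD)) (low_lt i' (ltnW tD)) => /= l l' /(congr1 (modn^~ (radix b (D - k.+1)))).
  by rewrite ![(_ + _ * _)%N]addnC !modnMDl !modn_small.
apply/ffunP => t; apply: val_inj; have := lowE (D - t.+1)%N (leq_subr _ _).
rewrite subKn // lowS lowS; have := lowE (D - t)%N (leq_subr _ _); rewrite subKn 1?ltnW // => ->.
move/addnI/eqP; rewrite eqn_mul2r => /orP[/eqP r0|/eqP //].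
by have := low_lt i (ltnW (ltn_ord t)); rewrite r0.
Qed.

Hypothesis b_gt0 : forall k, (0 < b k)%N.

Definition unflat (a : nat) : mindex b :=
  [ffun k : 'I_D => (Ordinal (ltn_pmod (a %/ radix b k) (b_gt0 k)) : 'I_(b k))].

Lemma unflatK a : (a < \prod_k b k)%N -> flat_pos (unflat a) = a.
Proof.
rewrite flat_posE -radix_all => aD; rewrite -[RHS](modn_small aD).
suff lowE t : (t <= D)%N -> low (unflat a) t = (a %% radix b t)%N by exact: lowE.
elim: t => [|t IH] tD; first by rewrite radix0 modn1 /low big_pred0.
rewrite (lowS _ (Ordinal tD)) (radixS (Ordinal tD)) IH ?(ltnW tD) // ffunE /=; have := b_gt0 (Ordinal tD).
have : (0 < radix b t)%N by rewrite prodn_gt0.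
move: (radix b t) (b _) => p c p0 c0.
have aE : a = (a %/ p %/ c * (p * c) + (a %% p + (a %/ p) %% c * p))%N.
  by rewrite {1}(divn_eq a p) {1}(divn_eq (a %/ p) c); ring.
have lt : (a %% p + (a %/ p) %% c * p < p * c)%N.
  have := ltn_pmod a p0; have := leq_mul (ltn_pmod (a %/ p) c0) (leqnn p).
  by move: (a %% p)%N (_ %% c)%N {aE} => r q; rewrite mulSn; lia.
by rewrite -[LHS](modn_small lt) -[LHS](modnMDl (a %/ p %/ c)) -aE.
Qed.

End Positions.

Section Omit.
Variables (d : nat) (b : 'I_d.+1 -> nat) (j : 'I_d.+1).

(** Deleting a coordinate of a multi-index deletes a digit of its position, in the sense of [key]. *)
Lemma flat_pos_omit (i : mindex b) :
  flat_pos (omit j i) = key (radix b j, radix b j * b j)%N (flat_pos i).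
Proof.
pose mid (k : 'I_d.+1) := (\prod_(l < d.+1 | j < l < k) b l)%N.
pose high := (\sum_(k < d.+1 | j < k) i k * mid k)%N.
have radixE (k : 'I_d.+1) : (j < k)%N -> radix b k = (radix b j.+1 * mid k)%N.
  move=> jk; rewrite /radix /mid (bigID (fun l : 'I_d.+1 => l < j.+1)%N) /=.
  by congr (_ * _)%N; apply: eq_bigl => l; lia.
have flatE : flat_pos i = (high * (radix b j * b j) + (low i j + i j * radix b j))%N.
  rewrite flat_posE -lowS /low (bigID (fun k : 'I_d.+1 => k < j.+1)%N) /= addnC.
  congr (_ + _)%N; last by apply: eq_bigl => k; rewrite ltn_ord.
  rewrite /high big_distrl /=; apply: eq_big => [k|k]; first by rewrite ltn_ord -leqNgt.
  by rewrite ltn_ord -leqNgt /= => jk; rewrite radixE // radixS; ring.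
have l_lt : (low i j + i j * radix b j < radix b j * b j)%N.
  by rewrite -lowS -radixS low_lt.
have b0 : (0 < radix b j * b j)%N by apply: leq_ltn_trans l_lt.
have r0 : (0 < radix b j)%N by move: b0; case: (radix b j).
have -> : key (radix b j, radix b j * b j)%N (flat_pos i) = (low i j + radix b j * high)%N.
  rewrite /key /= flatE divnMDl // (divn_small l_lt) addn0.
  have -> : (high * (radix b j * b j) + (low i j + i j * radix b j) =
      (high * b j + i j) * radix b j + low i j)%N by ring.
  by rewrite modnMDl modn_small // low_lt // ltnW.
have liftE (F : 'I_d.+1 -> nat) (P : pred 'I_d.+1) :
    (\sum_(k < d | P (lift j k)) F (lift j k) = \sum_(k | P k && (k != j)) F k)%N.
  rewrite (reindex_omap (lift j) (unlift j)) /= => [|k /andP[_]]; last first.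
    by case: unliftP => [k' ->|->] //; rewrite eqxx.
  by apply: eq_bigl => k; rewrite liftK eqxx andbT eq_sym neq_lift andbT.
have liftP (F : 'I_d.+1 -> nat) (P : pred 'I_d.+1) :
    (\prod_(k < d | P (lift j k)) F (lift j k) = \prod_(k | P k && (k != j)) F k)%N.
  rewrite [RHS](reindex_omap (lift j) (unlift j)) /= => [|k /andP[_]]; last first.
    by case: unliftP => [k' ->|->] //; rewrite eqxx.
  by apply: eq_bigl => k; rewrite liftK eqxx andbT eq_sym neq_lift andbT.
have lt_lift (k l : 'I_d) : (lift j k < lift j l)%N = (k < l)%N.
  by rewrite /= /bump; lia.
have neqE (k l : 'I_d.+1) : (k != l) = (k != l :> nat) by [].
pose G (k : 'I_d.+1) := (i k * \prod_(l < d.+1 | (l < k)%N && (l != j)) b l)%N.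
have -> : flat_pos (omit j i) = (\sum_(k | true && (k != j)) G k)%N.
  rewrite -(liftE G xpredT); apply: eq_bigr => k _.
  rewrite ffunE /G -liftP; congr (_ * _)%N; apply: eq_bigl => l.
  by rewrite lt_lift.
rewrite (bigID (fun k : 'I_d.+1 => k < j)%N) /=; congr (_ + _)%N.
  rewrite /low; apply: eq_big => k; first by rewrite neqE; lia.
  move=> kj; congr (_ * _)%N; apply: eq_bigl => l; rewrite neqE; lia.
rewrite /high big_distrr /=; apply: eq_big => k; first by rewrite neqE; lia.
move=> /andP[kj jk]; rewrite mulnCA /G; congr (_ * _)%N.
rewrite /radix /mid (bigID (fun l : 'I_d.+1 => l < j)%N) /=; congr (_ * _)%N.
  by apply: eq_bigl => l; move: kj jk; rewrite !neqE; lia.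
by apply: eq_bigl => l; rewrite !neqE; lia.
Qed.

End Omit.

(** * Transportation problems as defect minimisation *)

Lemma layout_flat_pos D (b : 'I_D -> nat) (w : {ffun mindex b -> int}) (i : mindex b) :
  layout w (flat_pos i)%:Z = w i.
Proof.
rewrite /layout; case: pickP => [i'|/(_ i)]; last by rewrite eqxx.
by rewrite eqz_nat => /eqP/flat_pos_inj->.
Qed.

Lemma radix_dvd D (b : 'I_D -> nat) (s t : nat) : (s <= t)%N -> (radix b s %| radix b t)%N.
Proof.
move=> st; rewrite /radix [X in (_ %| X)%N](bigID (fun k : 'I_D => k < s)%N) /=.
by rewrite dvdn_mulr // [X in (_ %| X)%N](eq_bigl (fun k : 'I_D => k < s)%N) // => k; lia.
Qed.

Section Encoding.
Variables (d : nat) (m : 'I_d -> nat) (m_gt0 : forall k, (0 < m k)%N).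

Definition layer_size : nat := (\prod_k m k)%N.

Lemma layer_size_gt0 : (0 < layer_size)%N.
Proof. exact: prodn_gt0. Qed.

(** The radices of all coordinates but the last one do not depend on the last side length, here
    set to 1; so neither do the directions, nor the program built from them. *)
Definition direction (j : 'I_d.+1) : nat * nat :=
  (radix (sides m 1) j, if j == ord_max then 0 else radix (sides m 1) j * sides m 1 j)%N.

Definition directions : seq (nat * nat) := [seq direction j | j <- enum 'I_d.+1].

Lemma size_directions : size directions = d.+1.
Proof. by rewrite size_map size_enum_ord. Qed.

Lemma nth_directions (j : 'I_d.+1) : dir directions j = direction j.
Proof. by rewrite (nth_map j) ?size_enum_ord // nth_ord_enum. Qed.

Lemma sides_lt n (k : 'I_d.+1) : (k < d)%N -> sides m n k = sides m 1 k.
Proof.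
by rewrite /sides; case: unliftP => [k' _ //|->]; rewrite ltnn.
Qed.

Lemma radix_sides n (j : nat) : (j <= d)%N -> radix (sides m n) j = radix (sides m 1) j.
Proof.
by move=> jd; apply: eq_bigr => k kj; rewrite (sides_lt n) // (leq_trans kj).
Qed.

Lemma radix_layer n : radix (sides m n) d = layer_size.
Proof.
rewrite /radix big_mkcond big_ord_recr /= ltnn muln1; apply: eq_bigr => k _.
rewrite /= ltn_ord /sides; case: unliftP => [k' /(congr1 val)|/(congr1 val)] /=.
  by rewrite /bump leqNgt ltn_ord => /val_inj->.
by move=> kd; have := ltn_ord k; rewrite kd ltnn.
Qed.

Lemma direction_of_directions : all (direction_of layer_size) directions.
Proof.
apply/allP => q /mapP[j _ ->] {q}; rewrite /direction_of /direction /=.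
have r0 : (0 < radix (sides m 1) j)%N.
  by apply: prodn_gt0 => k; rewrite /sides; case: unliftP.
rewrite r0 /=; have [->|/eqP jm] := eqVneq j ord_max; first by rewrite radix_layer eqxx.
have jd : (j < d)%N.
  by have := ltn_ord j; rewrite ltnS leq_eqVlt => /orP[/eqP jd|//]; case: jm; apply: val_inj.
apply/orP; right; apply/and3P; split; last by rewrite -radixS -(radix_layer 1) radix_dvd.
  by rewrite muln_gt0 r0 /=; rewrite /sides; case: unliftP.
exact: dvdn_mulr.
Qed.

Variables (n : nat) (n_gt0 : (0 < n)%N).
Local Notation b := (sides m n).
Local Notation N := (n * layer_size)%N.

Lemma sides_gt0 k : (0 < b k)%N.
Proof. by rewrite /sides; case: unliftP. Qed.

Lemma prod_sides : (\prod_k b k = N)%N.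
Proof.
rewrite -radix_all (radixS _ ord_max) radix_layer mulnC; congr (_ * _)%N.
by rewrite /sides unlift_none.
Qed.

Definition position (i : mindex b) : 'I_N := cast_ord prod_sides (Ordinal (flat_pos_lt i)).

Definition index_at (a : nat) : mindex b := unflat sides_gt0 a.

Lemma positionK : cancel position index_at.
Proof.
by move=> i; apply: flat_pos_inj; rewrite unflatK // flat_pos_lt.
Qed.

Lemma index_atK (a : 'I_N) : position (index_at a) = a.
Proof. by apply: val_inj; rewrite /= unflatK // prod_sides. Qed.

Lemma key_position (j : 'I_d.+1) (i : mindex b) :
  key (direction j) (position i) = flat_pos (omit j i).
Proof.
rewrite flat_pos_omit /direction; case: (eqVneq j ord_max) => [->|jm] /=.
  rewrite /key /= divn0 -(radix_sides n) // divn_small //.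
  by rewrite -(radixS b ord_max) radix_all flat_pos_lt.
have jd : (j < d)%N.
  have := ltn_ord j; rewrite ltnS leq_eqVlt => /orP[/eqP jd|//].
  by case/eqP: jm; apply: val_inj.
by rewrite -!(radix_sides n) ?(ltnW jd) // -(sides_lt n).
Qed.

Lemma omit_surjective (j : 'I_d.+1) (l : mindex (omit_sides b j)) : exists i, omit j i = l.
Proof.
have digits (k : 'I_d.+1) : exists x : 'I_(b k), forall k', k = lift j k' -> x = l k' :> nat.
  case: (unliftP j k) => [k' ->|->]; first by exists (l k') => k'' /lift_inj->.
  by exists (Ordinal (sides_gt0 j)) => k' e; have := neq_lift j k'; rewrite -e eqxx.
have [i iP] := fin_all_exists digits.
exists [ffun k => i k]; apply/ffunP => k; apply: val_inj.
by rewrite !ffunE /= (iP _ k).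
Qed.

Variables (w : {ffun mindex b -> int}) (v : line_sums b).

Definition weights (a : nat) : int := layout w a%:Z.

Definition demands (j a : nat) : int :=
  if insub j is Some j' then layout (v (j' : 'I_d.+1)) a%:Z else 0.

Lemma sum_position (R : Type) (idx : R) (op : Monoid.com_law idx) (P : pred 'I_N) (F : 'I_N -> R) :
  \big[op/idx]_(a | P a) F a = \big[op/idx]_(i | P (position i)) F (position i).
Proof.
apply: reindex; apply: onW_bij; exists (fun a : 'I_N => index_at a); [exact: positionK | exact: index_atK].
Qed.

Definition encode (x : {ffun mindex b -> nat}) : vec N := [ffun a : 'I_N => (x (index_at a))%:Z].

Lemma cost_encode x : cost weights (encode x) = transport_cost w x.
Proof.
rewrite /cost sum_position; apply: eq_bigr => i _.
by rewrite ffunE positionK /weights /= layout_flat_pos.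
Qed.

Lemma line_encode x (j : 'I_d.+1) (i : mindex b) :
  line (dir directions j) (encode x) (position i) =
  \sum_(i' | omit j i' == omit j i) (x i')%:Z.
Proof.
rewrite nth_directions /line sum_position; apply: eq_big => i' => [|_].
  by rewrite !key_position (inj_eq (@flat_pos_inj _ _)).
by rewrite ffunE positionK.
Qed.

Lemma demands_position (j : 'I_d.+1) (i : mindex b) :
  demands j (key (dir directions j) (position i)) = v j (omit j i).
Proof.
by rewrite nth_directions key_position /demands valK layout_flat_pos.
Qed.

Lemma feasible_encode x :
  transport_feasible v x <-> defect directions demands (encode x) = 0.
Proof.
rewrite defect_eq0 size_directions; split=> [fx a|h j l].
  split=> [|j]; first by rewrite ffunE.
  by rewrite -[a]index_atK line_encode demands_position fx.
have [i <-] := omit_surjective l; have [_ /(_ j)] := h (position i).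
by rewrite line_encode demands_position.
Qed.

Lemma encode_nonneg (y : vec N) : (forall a, 0 <= y a) ->
  y = encode [ffun i => `|y (position i)|%N].
Proof.
by move=> y0; apply/ffunP => a; rewrite !ffunE index_atK gez0_abs.
Qed.

End Encoding.

(** * The whole algorithm *)

Definition block_bits (c : prog) (tau b : nat) : nat := (b * (tau * psize c).+1)%N.

Definition block_cost (c : prog) (tau b : nat) : nat :=
  (tau * (8 * psize c + 2) * (b * (tau.+1 * psize c).+1 + 2))%N.

Lemma does_exec fixed c s tau b Q : does c s tau Q -> linear fixed c -> (0 < b)%N ->
  fits s predT b ->
  exists t s', [/\ exec c s t s', (t <= block_cost c tau b)%N,
    fits s' predT (block_bits c tau b) & Q s'].
Proof.
move=> [u [s' [r ut q]]] lin b0 sb; have [fb [t x tc]] := runs_cost r lin b0 sb.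
exists t, s'; split=> //.
  apply: leq_trans tc _; rewrite /block_cost leq_mul ?leq_mul2r ?ut ?orbT //.
  by rewrite leq_add2r leq_mul2l ltnS leq_mul2r ltnS ut !orbT.
move=> k a h; apply: leq_trans (fb k a h) _.
by rewrite leq_pexp2l // /block_bits leq_mul2l ltnS leq_mul2r ut !orbT.
Qed.

Section Solver.
Variables (d : nat) (m : 'I_d -> nat).
Hypothesis m_gt0 : forall k, (0 < m k)%N.
Variable K : nat.

Local Notation o := (d + 3)%N.
Local Notation qs := (directions m).
Local Notation M := (layer_size m).
Local Notation var := (var o).
Local Notation set := (set o).
Local Notation touched := (touched o).
Local Notation cell s i := ((s : store) (o + i)%N 0).

Fact o_large : (size qs + 2 <= o)%N.
Proof. by rewrite size_directions; lia. Qed.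

Definition setup : prog :=
  Seq (set nN (Bin Mul (Cst M) (Get 0 (Cst 0)))) (set nPen (Cst 1)).

Definition weigh : prog :=
  Seq (set nWgt (Cst 0))
    (for_loop o nI (set nWgt (Bin Add (var nWgt) (abs_expr (Get 1 (var nI)))))).

(** With penalty 1 and [x = 0], the objective is the total of the demands. *)
Definition survey : prog := Seq (objective o qs) weigh.

Definition penalty_expr : expr :=
  Bin Add (Bin Add (Bin Mul (Bin Mul (Cst 2) (var nWgt)) (var nAcc))
                   (Bin Mul (Cst 3) (var nWgt))) (Cst 1).

Definition bound_expr : expr :=
  Bin Add (var nAcc) (Bin Mul (Cst 3)
    (Bin Add (Bin Mul penalty_expr (var nAcc)) (Bin Mul (var nWgt) (var nAcc)))).

(** The expressions repeat [penalty_expr] because only [nWgt] and [nAcc] may be multiplied here. The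
    threshold that separates feasible from infeasible points goes to a spare cell of array 0. *)
Definition prepare : prog :=
  Seq (set nPen penalty_expr) (Seq (set nBest (Bin Mul penalty_expr (var nAcc)))
    (Seq (set nMax (Bin Mul (Cst 2) bound_expr)) (Seq (set nFlag (Cst 1))
      (Put 0 (Cst 1) (Bin Mul (var nWgt) (var nAcc)))))).

Definition finish : prog :=
  Seq (for_loop o nI (Put 1 (var nI) (Get (o + nX) (var nI))))
    (Put 0 (Cst 0) (Bin Leq (var nBest) (Get 0 (Cst 1)))).

Definition solver : prog :=
  Seq setup (Seq survey (Seq prepare (Seq (search o qs K) finish))).

Definition constant : pred nat := fun k => (k < o + 3)%N.

Lemma constantD i : constant (o + i) = (i < 3)%N.
Proof. by rewrite /constant ltn_add2l. Qed.

Lemma constant_lt i : (i < o)%N -> constant i.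
Proof. by rewrite /constant; lia. Qed.

Lemma linear_setup : linear pred0 setup.
Proof. by []. Qed.

Lemma linear_direction_tests j qs' : linear constant (direction_tests o j qs').
Proof.
elim: qs' j => // q qs' IH j; rewrite [linear _ _]/= !constantD IH /=.
by case: (constant _).
Qed.

Lemma linear_objective : linear constant (objective o qs).
Proof.
by rewrite /= linear_direction_tests !constantD /= (constant_lt (i := 1)) //; lia.
Qed.

Lemma linear_survey : linear constant survey.
Proof.
rewrite -[linear _ _]/(linear constant (objective o qs) && linear constant weigh).
by rewrite linear_objective /= !constantD /= (constant_lt (i := 1)) //; lia.
Qed.

Lemma linear_explore k : linear constant (explore o qs k).
Proof.
elim: k => [|k IH].
  by have := linear_objective; rewrite /= => ->; rewrite !constantD.
by rewrite /= IH !constantD.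
Qed.

Lemma linear_search : linear constant (search o qs K).
Proof.
by rewrite /= linear_explore !constantD.
Qed.

Lemma linear_finish : linear pred0 finish.
Proof. by []. Qed.

Lemma linear_prepare : linear (fun k => (k == o + nWgt) || (k == o + nAcc))%N prepare.
Proof.
by rewrite /= !eqn_add2l /= andbT; case: d.
Qed.

(** Time and bit bounds of the blocks, as functions of the number [N] of positions and of a
    bound [b] on the bits of the input cells. *)
Definition survey_time (N : nat) : nat := (objective_time qs N + (N * 3 + 3))%N.

Definition setup_bits (b : nat) : nat := block_bits setup 2 b.

Definition survey_bits (N b : nat) : nat := block_bits survey (survey_time N) (setup_bits b).

Definition prepare_bits (N b : nat) : nat := block_bits prepare 5 (survey_bits N b).

Definition doublings (N b : nat) : nat := (prepare_bits N b).+1.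

Definition improvement_ratio (N b : nat) : nat := (doublings N b * (2 * N).+1 ^ K)%N.

Definition solver_search_time (N b : nat) : nat :=
  search_time qs N K (doublings N b) (improvement_ratio N b) (prepare_bits N b).+2.

Definition search_bits (N b : nat) : nat :=
  block_bits (search o qs K) (solver_search_time N b) (prepare_bits N b).

Definition solver_cost (N b : nat) : nat :=
  (block_cost setup 2 b + (block_cost survey (survey_time N) (setup_bits b)
   + (block_cost prepare 5 (survey_bits N b)
      + (block_cost (search o qs K) (solver_search_time N b) (prepare_bits N b)
         + block_cost finish (N * 3 + 3) (search_bits N b)))))%N.

Section Run.
Variables (n : nat) (n_gt0 : (0 < n)%N).
Variables (w : {ffun mindex (sides m n) -> int}) (v : line_sums (sides m n)).
Local Notation N := (n * M)%N.
Local Notation input := (input_store w v).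
Local Notation penalised B := (@obj qs N (weights w) (demands v) B).
Local Notation W := (weight_bound N (weights w)).
Local Notation V := (demand_bound qs N (demands v)).
Local Notation P := (penalty qs N (weights w) (demands v)).
Local Notation vec_at := (vec_at o N).

Lemma input_zero i a : input (o + i)%N a = 0.
Proof.
rewrite (_ : (o + i = (d.+1 + i).+2)%N) /=; last by lia.
by rewrite insubF //; lia.
Qed.

Definition keeps_input (s : store) : Prop := forall k a, (0 < k < o)%N -> s k a = input k a.

Lemma keeps_input_agree I s s' : agree (touched I) s s' -> keeps_input s -> keeps_input s'.
Proof.
by move=> ag ki k a /andP[k0 ko]; rewrite ag ?touched_lt // ki ?k0.
Qed.

Lemma value_keeps_input s x : keeps_input s -> value o qs s x = penalised (cell s nPen) x.
Proof.
move=> ki; rewrite /value (_ : (fun a : nat => s 1%N a%:Z) = weights w); last first.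
  by apply: functional_extensionality => a; rewrite ki //; lia.
rewrite /obj; congr (_ + _ * _); apply: eq_bigr => a _; congr (_ + _); apply: eq_bigr => j _.
by rewrite ki //; have := ltn_ord j; have := o_large; lia.
Qed.

Lemma does_setup : does setup input 2
  (fun s => [/\ agree (touched [:: nN; nPen]) input s, cell s nN = N%:Z & cell s nPen = 1]).
Proof.
rewrite -[2%N]/(1 + 1)%N; apply/does_seq/does_put => /=; set s1 := upd _ _ _ _.
apply: does_put => /=; set s2 := upd _ _ _ _; split.
- by apply: (agree_trans (s2 := s1)); apply: agree_upd.
- by rewrite /s2 updD /= /s1 updD /= mulnC.
by rewrite /s2 updD.
Qed.

Lemma does_weigh s : cell s nN = N%:Z -> keeps_input s ->
  does weigh s (N * 3 + 3)
    (fun s' => agree (touched [:: nI; nWgt]) s s' /\ cell s' nWgt = W).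
Proof.
move=> sN ki; rewrite (_ : (N * 3 + 3 = 1 + (N * 3 + 2))%N); last lia.
apply/does_seq/does_put => /=; set s1 := upd _ _ _ _.
have := @does_for o [:: nWgt] nI (set nWgt (Bin Add (var nWgt) (abs_expr (Get 1 (var nI)))))
  s1 N 1 (fun j s' => cell s' nWgt = \sum_(a < j) `|weights w a|).
case=> //.
- by rewrite /= touchedD mem_head.
- by rewrite /s1 updD.
- by move=> j s2 z h; rewrite updD.
- by rewrite /s1 updD /= big_ord0.
- move=> j s2 jN ag sj h; apply: does_put; rewrite updD [_ && _]/=.
  rewrite -[eval _ _]/(cell s2 nWgt + eval s2 (abs_expr (Get 1 (var nI)))) eval_abs h.
  rewrite big_ord_recr /= sj; congr (_ + `|_|).
  have -> : s2 1%N j%:Z = s1 1%N j%:Z by apply: ag; rewrite touched_lt //; lia.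
  by rewrite /s1 upd_lt ?ki //; lia.
move=> t [s' [r le [ag h]]]; exists t, s'; split=> //; split=> //.
by apply: agree_trans ag; exact: agree_upd.
Qed.

Lemma does_survey s : agree (touched [:: nN; nPen]) input s -> cell s nN = N%:Z ->
  cell s nPen = 1 ->
  does survey s (survey_time N) (fun s' =>
    [/\ agree (touched [:: nN; nPen; nWgt; nAcc; nSum; nI; nJ]) input s', cell s' nN = N%:Z,
        cell s' nWgt = W & cell s' nAcc = V]).
Proof.
move=> ag sN s1.
have ki : keeps_input s by apply: keeps_input_agree ag _.
have xs : vec_at s nX = 0.
  by apply/ffunP => a; rewrite !ffunE ag ?touchedD // input_zero.
have sd : same_data o s s by [].
apply: does_bind (does_objective o_large sN sd) _ => s2 [ag2 acc2].
have s2N : cell s2 nN = N by rewrite ag2 ?touchedD.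
apply: does_le (does_weigh s2N (keeps_input_agree ag2 ki)) (leqnn _) _ => s3 [ag3 wgt3].
split=> //.
- apply: (agree_trans (s2 := s)); first by apply: agree_sub ag; apply: touched_sub => i;
    rewrite !inE => /orP[] /eqP->.
  apply: (agree_trans (s2 := s2)); [apply: agree_sub ag2 | apply: agree_sub ag3];
    by apply: touched_sub => i; rewrite !inE; lia.
- by rewrite ag3 ?touchedD.
by rewrite ag3 ?touchedD // acc2 xs value_keeps_input // s1 obj0 mul1r.
Qed.

Definition step_bound : int := 2 * (V + 3 * (P * V + W * V)).

Lemma does_prepare s :
  agree (touched [:: nN; nPen; nWgt; nAcc; nSum; nI; nJ]) input s -> cell s nN = N%:Z ->
  cell s nWgt = W -> cell s nAcc = V ->
  does prepare s 5 (fun s' =>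
    [/\ keeps_input s' /\ s' 0%N 1 = W * V, cell s' nN = N%:Z /\ cell s' nPen = P,
       cell s' nBest = P * V /\ cell s' nMax = step_bound, cell s' nFlag = 1
     & vec_at s' nX = 0 /\ vec_at s' nBestX = 0]).
Proof.
move=> ag sN sW sV; rewrite -[X in does _ _ X]/(1 + (1 + (1 + (1 + 1))))%N.
apply/does_seq/does_put => /=; set s1 := upd _ _ _ _.
apply/does_seq/does_put => /=; set s2 := upd _ _ _ _.
apply/does_seq/does_put => /=; set s3 := upd _ _ _ _.
apply/does_seq/does_put => /=; set s4 := upd _ _ _ _.
apply: does_put => /=; set s5 := upd _ _ _ _.
have ag4 : agree (touched [:: nPen; nBest; nMax; nFlag]) s s4.
  apply: (agree_trans (s2 := s1)); first exact: agree_upd.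
  apply: (agree_trans (s2 := s2)); first exact: agree_upd.
  by apply: (agree_trans (s2 := s3)); apply: agree_upd.
have s5E i a : s5 (o + i)%N a = s4 (o + i)%N a.
  by rewrite /s5 /upd; case: eqP => //; lia.
have ki4 : keeps_input s4 by apply: keeps_input_agree ag4 (keeps_input_agree ag _).
have [x4 x4'] : vec_at s4 nX = 0 /\ vec_at s4 nBestX = 0.
  by split; apply/ffunP => a; rewrite !ffunE ag4 ?touchedD // ag ?touchedD // input_zero.
split.
- split; last by rewrite /s5 /upd !eqxx /= ag4 ?touchedD // sW ag4 ?touchedD ?sV.
  by move=> [|k] a k0 //; exact: ki4.
- rewrite !s5E ag4 ?touchedD // sN; split=> //.
  by rewrite /s4 updD /= /s3 updD /= /s2 updD /= /s1 updD /= sW sV.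
- rewrite !s5E; split.
    by rewrite /s4 updD /= /s3 updD /= /s2 updD /= /s1 !updD /= sW sV.
  by rewrite /s4 updD /= /s3 updD /= /s2 !updD /= /s1 !updD /= sW sV.
- by rewrite s5E /s4 updD.
have vE i : vec_at s5 i = vec_at s4 i by apply/ffunP => a; rewrite !ffunE s5E.
by rewrite !vE x4 x4'.
Qed.

Lemma does_finish s : cell s nN = N%:Z ->
  does finish s (N * 3 + 3) (fun s' =>
    (forall a : 'I_N, s' 1%N (a : nat)%:Z = vec_at s nX a) /\
    s' 0%N 0 = if cell s nBest <= s 0%N 1 then 1 else 0).
Proof.
move=> sN; rewrite (_ : (N * 3 + 3 = (N * 3 + 2) + 1)%N); last lia.
have h := @does_for_loop o (pred1 1%N) nI (Put 1 (var nI) (Get (o + nX) (var nI))) s N 1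
  (fun j s' => forall a : nat, (a < j)%N -> s' 1%N a%:Z = s (o + nX)%N a%:Z).
have one i : (o + i == 1)%N = false by lia.
apply: (does_bind (t1 := (N * 3 + 2)%N) (h _ _ _ _ _ _ _ _)) => //=; rewrite ?one //.
- by move=> j s1 z e a aj; rewrite upd_lt ?e //; lia.
- move=> j s1 jN ag sj e; apply: does_put => a; rewrite ltnS /= sj => aj.
  rewrite /upd eqxx /= eqz_nat; have [->|ja] := eqVneq a j.
    by apply: ag; rewrite /= one eqn_add2l.
  by apply: e; rewrite ltn_neqAle ja.
move=> s1 [ag e]; apply: does_put; split=> [a|].
  by rewrite /upd /= e // ffunE.
rewrite /upd /= !ag //= ?one ?eqn_add2l //; lia.
Qed.

Hypothesis pieces : forall z : vec N, z != 0 ->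
  exists g, [/\ (norm1 g <= K)%N, g != 0 & conformal (@form qs N) g z].

Lemma good_step_exists (T : nat) (x y : vec N) : (forall z, penalised P y <= penalised P z) ->
  (`|step_bound| < 2 ^ T)%N ->
  penalised P x <= penalised P 0 -> penalised P y < penalised P x ->
  exists t, exists2 ms : seq (move N), size ms = K & (2 ^ t)%N%:Z <= step_bound /\
    penalised P x - penalised P y <= (T * (2 * N).+1 ^ K)%N%:Z *
      (penalised P x - penalised P (x + displacement ms *+ 2 ^ t)).
Proof.
move=> ymin LT le0 lt; pose T0 := up_log 2 `|step_bound|.+1.
have q0 : (0 < size qs)%N by rewrite size_directions.
have entry z a : penalised P z <= penalised P 0 -> 2 * `|z a| <= step_bound.
  move=> /(entry_le_sublevel q0 a); rewrite /step_bound; lia.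
have close a : (`|(y a - x a)%R| < 2 ^ T0)%N.
  apply: leq_trans (up_logP _ (ltnSn 1)); rewrite ltnS.
  by have := entry x a le0; have := entry y a (ymin 0); lia.
have [t tT [ms g]] := improving_step pieces (penalty_ge0 qs N (weights w) (demands v)) close lt.
exists t, ms; first exact: size_tuple.
have t_lt : (2 ^ t <= `|step_bound|)%N.
  by rewrite leqNgt; apply/negP => /up_log_min -/(_ (ltnSn 1)); rewrite leqNgt tT.
have b0 : 0 <= step_bound.
  have := defect_ge0 qs (demands v) (0 : vec N); rewrite -/(demand_bound _ _ _).
  have := weight_bound_ge0 N (weights w); have := penalty_ge0 qs N (weights w) (demands v).
  by rewrite /step_bound; move: W V P => w0 v0 p; nia.
split; first by lia.
have T0T : (T0 <= T)%N by apply: up_log_min.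
apply: (le_trans g); rewrite ler_wpM2r ?lez_nat ?leq_mul2r ?T0T ?orbT //.
have := lt; have := g; have : (0 <= T0 * (2 * N).+1 ^ K)%N by [].
move: (T0 * _)%N => k _; move: (penalised P x) (penalised P y) (penalised P _) => p1 p2 p3.
by nia.
Qed.

(** The search ends at a minimiser of the penalised objective. If its value is below the threshold
    it has no defect, hence it is an optimal solution; otherwise no point is free of defect. *)
Lemma solver_correct b : (0 < b)%N -> fits input predT b ->
  exists (t : nat) (s : store) (r : outcome {ffun mindex (sides m n) -> nat}),
    [/\ exec solver input t s, (t <= solver_cost N b)%N, outputs s r
      & solves (transport_feasible v) (transport_cost w) r].
Proof.
move=> b0 fit0.
have gt0 c tau b1 : (0 < b1)%N -> (0 < block_bits c tau b1)%N by rewrite muln_gt0 => ->.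
have [t1 [s1 [x1 c1 fit1 [ag1 n1 pen1]]]] := does_exec does_setup linear_setup b0 fit0.
have b1 := gt0 setup 2%N b b0.
have [t2 [s2 [x2 c2 fit2 [ag2 n2 wgt2 acc2]]]] :=
  does_exec (does_survey ag1 n1 pen1) linear_survey b1 fit1.
have b2 := gt0 survey (survey_time N) _ b1.
have [t3 [s3 [x3 c3 fit3 [[ki3 th3] [n3 pen3] [best3 max3] flag3 [xX3 xB3]]]]] :=
  does_exec (does_prepare ag2 n2 wgt2 acc2) linear_prepare b2 fit2.
have b3 := gt0 prepare 5%N _ b2.
rewrite -/(setup_bits b) -/(survey_bits N b) -/(prepare_bits N b) in fit3 b3.
have q0 : (0 < size qs)%N by rewrite size_directions.
have [y ymin] := minimizer_exists N (weights w) (demands v) q0.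
have valE x : value o qs s3 x = penalised P x by rewrite value_keeps_input // pen3.
have v0 : penalised P (0 : vec N) = P * V by rewrite obj0.
have Tbig : (`|cell s3 nMax| < 2 ^ doublings N b)%N.
  apply: leq_ltn_trans (fit3 _ _ isT) _; by rewrite ltn_exp2l.
have gap : (`|(value o qs s3 (0 : vec N) - penalised P y)%R| < 2 ^ (prepare_bits N b).+2)%N.
  rewrite valE v0 -best3; have := fit3 (o + nBest)%N 0 isT; have := fit3 0%N 1 isT.
  rewrite th3; have := obj_ge (weights w) (demands v) q0 y.
  have := defect_ge0 qs (demands v) y; have := weight_bound_ge0 N (weights w).
  have := ymin 0; rewrite v0 -best3.
  have V0 : 0 <= V by exact: defect_ge0.
  rewrite !expnS; have := expn_gt0 2 (prepare_bits N b); move: (2 ^ _)%N => B.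
  move: (cell s3 nBest) (penalised P y) (defect _ _ y) => c p D /= B0 pc W0 D0 ge.
  have : 0 <= (2 * W * V + 1) * D by move: W V W0 V0 {ge} => w0 v1; nia.
  by lia.
have sd3 : same_data o s3 s3 by [].
have rec3 : recorded o qs s3 N s3 by rewrite /recorded xB3 valE v0 best3.
have R0 : (0 < improvement_ratio N b)%N by rewrite muln_gt0 expn_gt0.
have opt_le (x : vec N) : penalised P y <= value o qs s3 x by rewrite valE.
have steps (x : vec N) : value o qs s3 x <= value o qs s3 (0 : vec N) -> penalised P y < value o qs s3 x ->
  exists t, exists2 ms : seq (move N), size ms = K & (2 ^ t)%N%:Z <= cell s3 nMax /\
    value o qs s3 x - penalised P y <= (improvement_ratio N b)%:Z *
      (value o qs s3 x - value o qs s3 (x + displacement ms *+ 2 ^ t)).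
  rewrite !valE max3 => le0 lt; have T' := Tbig; rewrite max3 in T'.
  have [t [ms msK [tL g]]] := good_step_exists ymin T' le0 lt.
  by exists t, ms => //; rewrite valE.
have [t4 [s4 [x4 c4 fit4 [sd4 rec4 xx4 best4]]]] :=
  does_exec (does_search o_large n3 Tbig R0 opt_le gap steps sd3 rec3 xX3 xB3 flag3)
    linear_search b3 fit3.
have b4 := gt0 (search o qs K) (solver_search_time N b) _ b3.
have n4 : cell s4 nN = N%:Z by rewrite sd4 ?ltn_add2l.
have [t5 [s5 [x5 c5 fit5 [out5 ver5]]]] := does_exec (does_finish n4) linear_finish b4 fit4.
pose x := [ffun i => `|vec_at s4 nX (position i)|%N] : {ffun mindex (sides m n) -> nat}.
exists (t1 + (t2 + (t3 + (t4 + t5))))%N, s5.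
have run : exec solver input (t1 + (t2 + (t3 + (t4 + t5)))) s5.
  exact: exec_seq x1 (exec_seq x2 (exec_seq x3 (exec_seq x4 x5))).
have time : (t1 + (t2 + (t3 + (t4 + t5))) <= solver_cost N b)%N.
  by rewrite !leq_add.
have valX : penalised P (vec_at s4 nX) = penalised P y by rewrite -valE xx4 -best4.
have [le|gt] := lerP (cell s4 nBest) (s4 0%N 1); last first.
  exists Empty; split=> //=; first by rewrite ver5 leNgt gt.
  move=> z /(feasible_encode m_gt0 n_gt0) z0.
  have [zc zW] := obj_feasible (weights w) q0 z0.
  have := ymin (encode m_gt0 n_gt0 z); rewrite zc.
  by move: gt; rewrite best4 sd4 ?th3; lia.
have d0 : defect qs (demands v) (vec_at s4 nX) = 0.
  apply/eqP/negP => /negP/(obj_infeasible (weights w) q0).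
  by rewrite valX -best4 ltNge -th3 -(sd4 0%N) ?le //; lia.
have pos a : 0 <= vec_at s4 nX a by have [] := iffLR (defect_eq0 qs (demands v) _) d0 a.
have xE : vec_at s4 nX = encode m_gt0 n_gt0 x by exact: encode_nonneg.
have x0 : transport_feasible v x by apply/(feasible_encode m_gt0 n_gt0); rewrite -xE.
exists (Optimal x); split=> //=.
  rewrite ver5 le; split=> // i; rewrite -[(flat_pos i)%:Z]/(position i : nat)%:Z out5.
  by rewrite [x i]ffunE gez0_abs.
split=> // z z0; have zd := iffLR (feasible_encode m_gt0 n_gt0 v z) z0.
have [zc _] := obj_feasible (weights w) q0 zd.
have [xc _] := obj_feasible (weights w) q0 d0.
by rewrite -!(cost_encode m_gt0 n_gt0) -zc -xE -xc valX.
Qed.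

End Run.
End Solver.

(** * Polynomial running time *)

Definition poly_bounded (f : nat -> nat -> nat) : Prop :=
  exists p : {poly {poly nat}}, forall n s : nat, (f n s <= p.[n%:P].[s])%N.

Lemma poly_bounded_le f g : (forall n s, f n s <= g n s)%N -> poly_bounded g -> poly_bounded f.
Proof. by move=> fg [p gp]; exists p => n s; apply: leq_trans (fg n s) (gp n s). Qed.

Lemma poly_bounded_cst c : poly_bounded (fun _ _ => c).
Proof. by exists (c%:P)%:P => n s; rewrite !hornerC. Qed.

Lemma poly_bounded_fst : poly_bounded (fun n _ => n).
Proof. by exists 'X => n s; rewrite hornerX hornerC. Qed.

Lemma poly_bounded_snd : poly_bounded (fun _ s => s).
Proof. by exists ('X)%:P => n s; rewrite hornerC hornerX. Qed.

Lemma poly_boundedD f g : poly_bounded f -> poly_bounded g ->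
  poly_bounded (fun n s => f n s + g n s)%N.
Proof.
by move=> [p fp] [q gq]; exists (p + q) => n s; rewrite !hornerD; apply: leq_add.
Qed.

Lemma poly_boundedM f g : poly_bounded f -> poly_bounded g ->
  poly_bounded (fun n s => f n s * g n s)%N.
Proof.
by move=> [p fp] [q gq]; exists (p * q) => n s; rewrite !hornerM; apply: leq_mul.
Qed.

Lemma poly_boundedS f : poly_bounded f -> poly_bounded (fun n s => (f n s).+1).
Proof.
move=> fp; apply: (@poly_bounded_le _ (fun n s => f n s + 1)%N) => [n s|]; first by rewrite addn1.
exact: poly_boundedD fp (poly_bounded_cst 1).
Qed.

Lemma poly_boundedX f k : poly_bounded f -> poly_bounded (fun n s => f n s ^ k)%N.
Proof.
move=> fp; elim: k => [|k IH]; first exact: poly_bounded_cst.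
by apply: (@poly_bounded_le _ (fun n s => f n s * f n s ^ k)%N) => [n s|];
  [rewrite expnS | apply: poly_boundedM].
Qed.

Ltac poly_bound := repeat first
  [ assumption | exact: poly_bounded_fst | exact: poly_bounded_snd | exact: poly_bounded_cst
  | apply: poly_boundedD | apply: poly_boundedM | apply: poly_boundedS | apply: poly_boundedX ].

Lemma poly_bounded_block_bits c tau b : poly_bounded tau -> poly_bounded b ->
  poly_bounded (fun n s => block_bits c (tau n s) (b n s)).
Proof. by move=> ? ?; rewrite /block_bits; poly_bound. Qed.

Lemma poly_bounded_block_cost c tau b : poly_bounded tau -> poly_bounded b ->
  poly_bounded (fun n s => block_cost c (tau n s) (b n s)).
Proof. by move=> ? ?; rewrite /block_cost; poly_bound. Qed.

Section SolverBound.
Variables (d : nat) (m : 'I_d -> nat) (K : nat) (N b : nat -> nat -> nat).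
Hypotheses (polyN : poly_bounded N) (polyb : poly_bounded b).

Lemma poly_bounded_objective_time : poly_bounded (fun n s => objective_time (directions m) (N n s)).
Proof. by rewrite /objective_time; poly_bound. Qed.

Lemma poly_bounded_explore_time k :
  poly_bounded (fun n s => explore_time (directions m) (N n s) k).
Proof.
have := poly_bounded_objective_time => ?.
by elim: k => [|k IH] /=; rewrite /compare_time; poly_bound.
Qed.

Lemma poly_bounded_prepare_bits : poly_bounded (fun n s => prepare_bits m (N n s) (b n s)).
Proof.
have := poly_bounded_objective_time => ?.
apply: poly_bounded_block_bits; first exact: poly_bounded_cst.
apply: poly_bounded_block_bits; first by rewrite /survey_time; poly_bound.
by apply: poly_bounded_block_bits; poly_bound.
Qed.

Lemma poly_bounded_search_time :
  poly_bounded (fun n s => solver_search_time m K (N n s) (b n s)).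
Proof.
have := poly_bounded_explore_time K => ?; have := poly_bounded_prepare_bits => ?.
rewrite /solver_search_time /search_time /round_time /scan_time /improvement_ratio /doublings.
by poly_bound.
Qed.

Lemma poly_bounded_solver_cost : poly_bounded (fun n s => solver_cost m K (N n s) (b n s)).
Proof.
have := poly_bounded_objective_time => ?; have := poly_bounded_search_time => ?.
have := poly_bounded_prepare_bits => ?.
have ? : poly_bounded (fun n s => survey_time m (N n s)) by rewrite /survey_time; poly_bound.
have ? : poly_bounded (fun n s => setup_bits m (b n s)).
  by apply: poly_bounded_block_bits; poly_bound.
have ? : poly_bounded (fun n s => survey_bits m (N n s) (b n s)).
  exact: poly_bounded_block_bits.
have ? : poly_bounded (fun n s => search_bits m K (N n s) (b n s)).
  exact: poly_bounded_block_bits.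
rewrite /solver_cost.
have cost c tau b' := @poly_bounded_block_cost c tau b'.
do 4 (apply: poly_boundedD; first by apply: cost; first [assumption | poly_bound]).
by apply: cost; first [assumption | poly_bound].
Qed.

End SolverBound.

Lemma layout_fits D (b : 'I_D -> nat) (w : {ffun mindex b -> int}) a :
  (`|layout w a| <= 2 ^ array_size w)%N.
Proof.
rewrite /layout; case: pickP => [i _|_]; last by [].
apply: leq_trans (ltnW (absz_lt_exp_bitlen _)) _; rewrite leq_pexp2l //.
by rewrite /array_size (bigD1 i) //= leq_addr.
Qed.

Lemma input_fits d (m : 'I_d -> nat) n (w : {ffun mindex (sides m n) -> int})
    (v : line_sums (sides m n)) :
  fits (input_store w v) predT (n + (array_size w + line_sums_size v)).+1.
Proof.
have le (z : int) k : (`|z| <= 2 ^ k)%N -> (k <= n + (array_size w + line_sums_size v))%N ->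
    (`|z| <= 2 ^ (n + (array_size w + line_sums_size v)).+1)%N.
  by move=> zk ks; apply: leq_trans zk _; rewrite leq_pexp2l //; lia.
move=> [|[|k]] a _ /=.
- apply: (le _ n); last lia.
  by case: ifP => _ //; exact: ltnW (ltn_expl n (ltnSn 1)).
- by apply: le (layout_fits _ _) _; lia.
case: insubP => [j _ _|_]; last by [].
apply: le (layout_fits _ _) _; rewrite /line_sums_size (bigD1 j) //=; lia.
Qed.
Theorem theorem2p2 (d : nat) (m : 'I_d -> nat)
    (d_gt0 : (0 < d)%N) (m_gt0 : forall j : 'I_d, (0 < m j)%N) :
  exists (c : prog) (p : {poly {poly nat}}),
    forall (n : nat) (n_gt0 : (0 < n)%N)
           (w : {ffun mindex (sides m n) -> int}) (v : line_sums (sides m n)),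
    exists (t : nat) (s : store) (o : outcome {ffun mindex (sides m n) -> nat}),
      [/\ exec c (input_store w v) t s,
          (t <= p.[n%:P].[array_size w + line_sums_size v])%N,
          outputs s o
        & solves (transport_feasible v) (transport_cost w) o].
Proof.
have [K pieces] := bounded_conformal_piece (layer_size_gt0 m_gt0) (direction_of_directions m_gt0).
have [p cost_p] := @poly_bounded_solver_cost d m K
  (fun n _ => n * layer_size m)%N (fun n s => (n + s).+1)
  ltac:(poly_bound) ltac:(poly_bound).
exists (solver m K), p => n n_gt0 w v.
have [t [s [r [x c out sol]]]] :=
  solver_correct m_gt0 n_gt0 (pieces n) (ltn0Sn _) (input_fits w v).
by exists t, s, r; split=> //; apply: leq_trans c (cost_p _ _).
Qed.
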